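(* Let $n\ge 3$ be an integer, let $K$ be a field containing $n$ distinct $n$-th roots of $1$, let $R=K[x,y,z]$, put $f=y^n-z^n$, $g=z^n-x^n$, $h=x^n-y^n$, and let $I=(xf,yg,zh)$. Then: (1) If $n\ge 4$, then $I^{(n)}$ has no homogeneous reduction with two generators. (2) A homogeneous minimal reduction of $I^{(n)}$ is $$J=\begin{cases}(fgh,\ gf^2x^n+hg^2y^n+fh^2z^n)&\text{if } n=3,\\ (f^{n-2}gh,\ fg^{n-2}h,\ g^{n-2}f^2x^n+h^{n-2}g^2y^n+f^{n-2}h^2z^n)&\text{if } n\ge 4,\end{cases}$$ and in either case the reduction number of $I^{(n)}$ with respect to $J$ is $1$.
   Context: $I^{(m)}$ denotes the $m$-th symbolic power of $I$, $I^{(m)}=\bigcap_{\mathfrak p\in \mathrm{Ass}(R/I)}(I^mR_{\mathfrak p}\cap R)$; for this ideal it is equivalently $(x^n-y^n,y^n-z^n)^m\cap(x,y)^m\cap(y,z)^m\cap(z,x)^m$. For ideals $J\subset A$ of $R$, $J$ is a reduction of $A$ if there is a non-negative integer $t$ with $A^{t+1}=JA^t$; the minimum such $t$ is the reduction number of $A$ with respect to $J$. The reduction $J$ is minimal if no ideal strictly contained in $J$ is in turn a reduction of $A$. A reduction is called homogeneous if it is a homogeneous ideal.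
   Formalization: For n ≥ 4, ''homogeneous minimal reduction'' is read as minimal among homogeneous reductions, since J is not minimal among all ideals (a smaller inhomogeneous reduction exists, seen at the point (1,1,1)); for n = 3 minimality among all ideals is proved. *)

(* Defs.v *)
From HB Require Import structures.
From mathcomp Require Import all_boot all_order all_algebra.
From mathcomp Require Export fraction mpoly.

Set Implicit Arguments.
Unset Strict Implicit.
Unset Printing Implicit Defensive.

Import GRing.Theory.
Local Open Scope ring_scope.

Local Notation "x %:F" := (@FracField.tofrac _ x).

(* Ideals are Prop-valued predicates: the structures [idealr] and
   [prime_idealr] of ring_quotient.v require decidable membership, which
   is not available for symbolic powers over an arbitrary field.
   Equality of ideals is extensional equality [eq_ideal]. *)
Section Ideals.
Variable R : comNzRingType.
Implicit Types (I J A p S : R -> Prop).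

Definition is_ideal I : Prop :=
  [/\ I 0, (forall a b, I a -> I b -> I (a + b))
    & (forall c a, I a -> I (c * a))].

Definition sub_ideal I J : Prop := forall a, I a -> J a.

Definition eq_ideal I J : Prop := forall a, I a <-> J a.

Definition proper_sub_ideal I J : Prop := sub_ideal I J /\ ~ sub_ideal J I.

Definition ideal_span S : R -> Prop := fun r =>
  exists (k : nat) (c s : 'I_k -> R),
    (forall i, S (s i)) /\ r = \sum_(i < k) c i * s i.

Definition ideal_gen (s : seq R) : R -> Prop := ideal_span (fun r => r \in s).

Definition ideal_mul I J : R -> Prop :=
  ideal_span (fun r => exists a b, [/\ I a, J b & r = a * b]).

Definition ideal_exp I (m : nat) : R -> Prop :=
  iter m (ideal_mul I) (fun _ => True).

Definition is_prime_ideal p : Prop :=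
  [/\ is_ideal p, ~ p 1 & (forall a b, p (a * b) -> p a \/ p b)].

(* p is the annihilator of the class of a in R / I. *)
Definition associated_prime I p : Prop :=
  is_prime_ideal p /\ exists a, forall r, p r <-> I (r * a).

Definition reduction_in J A (t : nat) : Prop :=
  eq_ideal (ideal_exp A t.+1) (ideal_mul J (ideal_exp A t)).

Definition is_reduction J A : Prop :=
  [/\ is_ideal J, is_ideal A, sub_ideal J A & exists t, reduction_in J A t].

Definition is_minimal_reduction J A : Prop :=
  is_reduction J A /\ ~ exists L, proper_sub_ideal L J /\ is_reduction L A.

Definition is_reduction_number J A (t : nat) : Prop :=
  reduction_in J A t /\ forall s, reduction_in J A s -> (t <= s)%N.

End Ideals.

Section SymbolicPower.
Variable R : idomainType.
Implicit Types (I p : R -> Prop).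

(* The localization R_p, as a subset of the fraction field of R. *)
Definition localization p : {fraction R} -> Prop := fun u =>
  exists a s, ~ p s /\ u = a%:F / s%:F.

Definition extended_ideal p I : {fraction R} -> Prop := fun u =>
  exists (k : nat) (c : 'I_k -> {fraction R}) (a : 'I_k -> R),
    [/\ (forall i, localization p (c i)), (forall i, I (a i))
      & u = \sum_(i < k) c i * (a i)%:F].

Definition contracted_ideal p I : R -> Prop := fun r => extended_ideal p I r%:F.

Definition symbolic_power I (m : nat) : R -> Prop := fun r =>
  forall p, associated_prime I p -> contracted_ideal p (ideal_exp I m) r.

End SymbolicPower.

Section Homogeneous.
Variables (K : fieldType) (k : nat).
Implicit Types (I J A : {mpoly K[k]} -> Prop).

Definition is_homogeneous I : Prop :=
  forall q (d : nat), I q -> I (pihomog mdeg d q).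

Definition is_homogeneous_reduction J A : Prop :=
  is_reduction J A /\ is_homogeneous J.

(* Minimality is tested among homogeneous reductions: a homogeneous reduction
   that is minimal in this sense may properly contain an inhomogeneous
   reduction, and then it is not an [is_minimal_reduction].  For the symbolic
   power of [fermat_ideal n] with 4 <= n and K infinite this does happen: the
   three generators of J are independent modulo (x - 1, y - 1, z - 1) J,
   whereas A has analytic spread 2 at the point (1, 1, 1). *)
Definition is_homogeneous_minimal_reduction J A : Prop :=
  is_homogeneous_reduction J A /\
  ~ exists L, proper_sub_ideal L J /\ is_homogeneous_reduction L A.

End Homogeneous.

Section FermatIdeal.
Variables (K : fieldType) (n : nat).

Definition var_x : {mpoly K[3]} := 'X_(@Ordinal 3 0 isT).
Definition var_y : {mpoly K[3]} := 'X_(@Ordinal 3 1 isT).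
Definition var_z : {mpoly K[3]} := 'X_(@Ordinal 3 2 isT).

Definition fermat_f : {mpoly K[3]} := var_y ^+ n - var_z ^+ n.
Definition fermat_g : {mpoly K[3]} := var_z ^+ n - var_x ^+ n.
Definition fermat_h : {mpoly K[3]} := var_x ^+ n - var_y ^+ n.

Definition fermat_ideal : {mpoly K[3]} -> Prop :=
  ideal_gen [:: var_x * fermat_f; var_y * fermat_g; var_z * fermat_h].

End FermatIdeal.

Arguments fermat_ideal : clear implicits.

(* Main.v *)
Require Import Defs.
From mathcomp Require Import all_boot all_order all_algebra.
From mathcomp Require Import perm ring zify.
From Stdlib Require Import Classical FunctionalExtensionality PropExtensionality.

Set Implicit Arguments.
Unset Strict Implicit.
Unset Printing Implicit Defensive.

Import GRing.Theory.
Local Open Scope ring_scope.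

(* Put D = (f, g) and let P range over (y, z), (z, x), (x, y).  The associated
   primes of I are the three P and the ideals of the n^2 common zeros of f and
   g, and I^(n) = A := D^n meet the three P^n, since powers of complete
   intersections have no embedded components.

   Modulo f, an element of D^2n and of (y, z)^2n is g^2n z^n a with a in
   (y, z)^n, while the last generator q of J is (-1)^n g^n z^n and
   g^(n-1) h a is - g^n a; moreover g^(n-1) h a lies in A because g and h vanish
   to order n on the two other axes.  Doing this for f, g, h in turn writes any element of A^2, up to
   J A, as f g h e with e in D^(2n-3) and in the P^n, and such an e lies in
   f^(n-3) A + g^(n-3) A.  Hence A^2 = J A.

   For n >= 4 the lowest component of A, in degree n^2, consists of multiples of
   f g h.  The initial forms of a reduction cannot all be multiples of one form,
   whence two generators are not enough and a homogeneous reduction inside J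
   contains the first two generators of J; it contains q by comparing degrees
   modulo f.  For n = 3, J is generated by a regular sequence, hence has no
   proper reduction. *)

(** Everything rests on f + g + h = 0: modulo one of the three forms the other two are opposite, and
    any two of them generate D. The cyclic shift of the variables permutes the axes and fixes D, so
    each argument is made for f and the axis (y, z) and then transported; hence the ring with
    abstract [coordinates]. Dividing by f g h lowers the exponent of D by three and each axis
    exponent by n, because just one of f, g, h vanishes on a given axis. So 2n turns into 2n - 3 =
    (n - 3) + n, which fits the first two generators of J, namely f^(n-3) and g^(n-3) times f g h.
    The delicate point is that splitting an element of D^(2n-3) along f^(n-3) and g^(n-3) controls D
    only: both parts must then be corrected to lie in the axis powers. The cases separate because f
    g h has degree 3n. For n >= 4 this is less than n^2, which leaves room for a degree
    contradiction; for n = 3 it equals n^2, and an argument on integral dependence takes over. *)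

Section Divisibility.
Variable R : idomainType.
Implicit Types a b c r s : R.

Definition divides a r := exists c, r = a * c.

(** That is, b is a non-zero-divisor modulo a; for nonzero a this is what is used of a regular
    sequence (a, b). *)
Definition prime_to a b := forall r, divides a (b * r) -> divides a r.

Lemma dividesD a r s : divides a r -> divides a s -> divides a (r + s).
Proof. by move=> [c ->] [d ->]; exists (c + d); rewrite mulrDr. Qed.

Lemma divides_mull a r s : divides a r -> divides a (s * r).
Proof. by move=> [c ->]; exists (s * c); rewrite mulrCA. Qed.

Lemma divides_mulr a r s : divides a r -> divides a (r * s).
Proof. by rewrite mulrC; exact: divides_mull. Qed.

Lemma dividesN a r : divides a r -> divides a (- r).
Proof. by rewrite -mulN1r; exact: divides_mull. Qed.

Lemma dividesB a r s : divides a r -> divides a s -> divides a (r - s).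
Proof. by move=> ? /dividesN; exact: dividesD. Qed.

Lemma divides_refl a : divides a a.
Proof. by exists 1; rewrite mulr1. Qed.

Lemma divides0 a : divides a 0.
Proof. by exists 0; rewrite mulr0. Qed.

Lemma divides_trans a b r : divides a b -> divides b r -> divides a r.
Proof. by move=> [c ->] [d ->]; exists (c * d); rewrite mulrA. Qed.

Lemma prime_to1 a : prime_to a 1.
Proof. by move=> r; rewrite mul1r. Qed.

Lemma prime_toM a b c : prime_to a b -> prime_to a c -> prime_to a (b * c).
Proof. by move=> ab ac r; rewrite -mulrA => /ab/ac. Qed.

Lemma prime_toX a b k : prime_to a b -> prime_to a (b ^+ k).
Proof.
move=> ab; elim: k => [|k IHk]; first by rewrite expr0; exact: prime_to1.
by rewrite exprS; exact: prime_toM.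
Qed.

Lemma prime_toN a b : prime_to a b -> prime_to a (- b).
Proof. by move=> ab r; rewrite mulNr => /dividesN; rewrite opprK => /ab. Qed.

Lemma prime_to_congr a b c : divides a (b - c) -> prime_to a c -> prime_to a b.
Proof.
move=> abc ac r /dividesB /(_ (divides_mulr r abc)) abr.
by apply: ac; rewrite (_ : c * r = b * r - (b - c) * r) //; ring.
Qed.

Lemma prime_to_sym a b : a != 0 -> prime_to a b -> prime_to b a.
Proof.
move=> a0 ab r [c arbc].
have [|d cad] := ab c; first by exists r.
by exists d; apply: (mulfI a0); rewrite arbc cad mulrCA.
Qed.

Lemma divides_mul_prime_to a b r :
  prime_to b a -> divides a r -> divides b r -> divides (a * b) r.
Proof. by move=> ba [c ->] /ba [d ->]; exists d; rewrite mulrA. Qed.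

Lemma prime_to_prod (I : Type) (s : seq I) (F : I -> R) b :
  (forall i, F i != 0) -> (forall i, prime_to (F i) b) ->
  prime_to (\prod_(i <- s) F i) b.
Proof.
move=> F0 Fb; elim: s => [|i s IHs] r.
  by rewrite big_nil => _; exists r; rewrite mul1r.
rewrite big_cons => -[c e].
have [|d def_r] := Fb i r; first by exists ((\prod_(j <- s) F j) * c); rewrite e mulrA.
have [|d' def_d] := IHs d.
  by exists c; apply: (mulfI (F0 i)); rewrite [RHS]mulrA -e def_r mulrCA.
by exists d'; rewrite def_r def_d mulrA.
Qed.

End Divisibility.

(** * Powers of an ideal generated by a regular pair *)

Section Pow2.
Variable R : idomainType.
Implicit Types (a b c d r s : R) (m k : nat).

(* [pow2 a b m] is the ideal (a, b)^m, in a form adapted to peeling off [a]: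
   (a, b)^(m+1) = a (a, b)^m + (b^(m+1)). *)
Fixpoint pow2 a b m r : Prop :=
  if m is m'.+1 then exists d s, pow2 a b m' d /\ r = a * d + b ^+ m * s
  else True.

Lemma pow2_0 a b m : pow2 a b m 0.
Proof. by elim: m => //= m IHm; exists 0, 0; split=> //; rewrite !mulr0 addr0. Qed.

Lemma pow2D a b m r s : pow2 a b m r -> pow2 a b m s -> pow2 a b m (r + s).
Proof.
elim: m r s => //= m IHm _ _ [d [u [dm ->]]] [d' [u' [dm' ->]]].
by exists (d + d'), (u + u'); split; [exact: IHm | ring].
Qed.

Lemma pow2_mull a b m c r : pow2 a b m r -> pow2 a b m (c * r).
Proof.
elim: m r => //= m IHm _ [d [u [dm ->]]].
by exists (c * d), (c * u); split; [exact: IHm | ring].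
Qed.

Lemma pow2_mulr a b m c r : pow2 a b m r -> pow2 a b m (r * c).
Proof. by rewrite mulrC; exact: pow2_mull. Qed.

Lemma pow2N a b m r : pow2 a b m r -> pow2 a b m (- r).
Proof. by rewrite -mulN1r; exact: pow2_mull. Qed.

Lemma pow2B a b m r s : pow2 a b m r -> pow2 a b m s -> pow2 a b m (r - s).
Proof. by move=> ? /pow2N; exact: pow2D. Qed.

Lemma pow2_ideal a b m : is_ideal (pow2 a b m).
Proof. split; [exact: pow2_0 | exact: pow2D | exact: pow2_mull]. Qed.

Lemma pow2_fst a b m r : pow2 a b m r -> pow2 a b m.+1 (a * r).
Proof. by move=> rm; exists r, 0; rewrite mulr0 addr0. Qed.

Lemma pow2_snd a b m r : pow2 a b m r -> pow2 a b m.+1 (b * r).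
Proof.
elim: m r => [r _ | m IHm _ [d [u [dm ->]]]].
  by exists 0, r; rewrite mulr0 add0r expr1.
by exists (b * d), u; split; [exact: IHm | rewrite (exprS b m.+1); ring].
Qed.

Lemma pow2M a b m k r s : pow2 a b m r -> pow2 a b k s -> pow2 a b (m + k) (r * s).
Proof.
elim: m r => [r _ sk | m IHm _ [d [u [dm ->]]] sk].
  by rewrite add0n; exact: pow2_mull.
rewrite addSn mulrDl -!mulrA; apply: pow2D; first by apply: pow2_fst; exact: IHm.
have {IHm dm d} : pow2 a b k (u * s) by exact: pow2_mull.
elim: m {u} (u * s) => [|m IHm] t tk; first by rewrite expr1; exact: pow2_snd.
by rewrite exprS -mulrA addSn; apply: pow2_snd; exact: IHm.
Qed.

Lemma pow2_gen1 a b : pow2 a b 1 a.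
Proof. by exists 1, 0; rewrite !mulr1 mulr0 addr0. Qed.

Lemma pow2_gen2 a b : pow2 a b 1 b.
Proof. by exists 0, 1; rewrite mulr0 mulr1 add0r. Qed.

Lemma pow2X a b m k r : pow2 a b m r -> pow2 a b (k * m) (r ^+ k).
Proof.
move=> rm; elim: k => // k IHk; rewrite exprS mulSn; exact: pow2M.
Qed.

Lemma pow2X1 a b k r : pow2 a b 1 r -> pow2 a b k (r ^+ k).
Proof. by move=> /(pow2X k); rewrite muln1. Qed.

Lemma pow2S a b m r : pow2 a b m.+1 r -> pow2 a b m r.
Proof.
elim: m r => // m IHm _ [d [u [dm ->]]].
by exists d, (b * u); split; [exact: IHm | rewrite (exprS b m.+1); ring].
Qed.

Lemma pow2W a b m k r : (k <= m)%N -> pow2 a b m r -> pow2 a b k r.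
Proof.
move/subnK <-; elim: (m - k)%N => // j IHj; rewrite addSn => /pow2S; exact: IHj.
Qed.

(** Induction principle for the powers of (a, b): it serves both to change generators and to bound
    degrees from below. *)
Lemma pow2_min a b (L : nat -> R -> Prop) m r :
  (forall k, is_ideal (L k)) -> L 0%N 1 ->
  (forall k c, L k c -> L k.+1 (a * c) /\ L k.+1 (b * c)) ->
  pow2 a b m r -> L m r.
Proof.
move=> idL L0 LS; elim: m r => [r _ | m IHm _ [d [u [dm ->]]]].
  by rewrite -(mulr1 r); case: (idL 0%N) => _ _; apply.
case: (idL m.+1) => _ addL mulL; apply: addL; first by case: (LS m d); auto.
rewrite mulrC; apply: mulL.
elim: m.+1 => // j Lj; rewrite exprS; by case: (LS _ _ Lj).
Qed.

Lemma pow2_sub a b a' b' m r :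
  pow2 a b 1 a' -> pow2 a b 1 b' -> pow2 a' b' m r -> pow2 a b m r.
Proof.
move=> aa' bb'; apply: pow2_min => // [k|k c ck]; first exact: pow2_ideal.
by rewrite -add1n; split; exact: pow2M.
Qed.

Lemma pow2C a b m r : pow2 a b m r -> pow2 b a m r.
Proof. apply: pow2_sub; [exact: pow2_gen2 | exact: pow2_gen1]. Qed.

Lemma pow2_mod_fst a b m r : pow2 a b m r -> exists c, divides a (r - b ^+ m * c).
Proof.
case: m => [_|m [d [u [_ ->]]]].
  by exists r; rewrite mul1r subrr; exact: divides0.
by exists u; exists d; ring.
Qed.

(** A monomial of degree j + k has exponent at least j in a or at least k + 1 in b. The truncation
    in [j.-1] concerns j = 0 only, where s can be taken to be 0. *)
Lemma pow2_split a b j k r : pow2 a b (j + k) r ->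
  exists d s, [/\ pow2 a b k d, pow2 a b j.-1 s & r = a ^+ j * d + b ^+ k.+1 * s].
Proof.
elim: j k r => [|j IHj] k r.
  by rewrite add0n => rk; exists r, 0; split=> //=; rewrite mul1r mulr0 addr0.
rewrite addSnnS => /IHj [d [s [[d' [u [d'k ->]]] sj ->]]].
exists d', (a ^+ j * u + b * s); split => //; last by rewrite !exprS; ring.
case: j {IHj} sj => [|j] sj //; rewrite -pred_Sn.
apply: pow2D; last exact: pow2_snd.
by apply: pow2_mulr; apply: pow2X1; exact: pow2_gen1.
Qed.

(** The leading form of a is regular on the associated graded ring: in a r = a d + b^(m+1) u, a
    divides u, and a cancels. *)
Lemma pow2_cancel a b m r :
  a != 0 -> prime_to a b -> pow2 a b m.+1 (a * r) -> pow2 a b m r.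
Proof.
move=> a0 ab [d [u [dm e]]].
have [|v def_u] := @prime_toX _ a b m.+1 ab u.
  by exists (r - d); rewrite mulrBr e addrC addKr.
have -> : r = d + b ^+ m.+1 * v.
  by apply: (mulfI a0); rewrite e def_u; ring.
apply: pow2D => //; apply: pow2_mulr; apply: pow2S.
by apply: pow2X1; exact: pow2_gen2.
Qed.

(* Powers of a complete intersection (a, b) have no embedded components. *)
Lemma pow2_primary (T : Type) (P : T -> R -> Prop) a b m r :
  a != 0 -> prime_to a b ->
  (forall i c, pow2 a b 1 c -> P i c) ->
  (forall c, (forall i, P i c) -> pow2 a b 1 c) ->
  (forall i c d, P i (c * d) -> P i c \/ P i d) ->
  (forall i, exists s, ~ P i s /\ pow2 a b m (s * r)) -> pow2 a b m r.
Proof.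
move=> a0 ab DP PD primeP; elim: m r => // m IHm r Hr.
have rm : pow2 a b m r.
  by apply: IHm => i; have [s [sP rs]] := Hr i; exists s; split=> //; exact: pow2S.
case: m IHm Hr rm => [|m] IHm Hr rm.
  apply: PD => i; have [s [sP /(DP i) rs]] := Hr i.
  by case: (primeP _ _ _ rs).
have [d [c [dm def_r]]] := rm.
(* Comparing two expressions of s r modulo a and cancelling b^(m+1) gives s c in (a, b); as s avoids
   the i-th prime, c lies in each of them. *)
have c1 : pow2 a b 1 c.
  apply: PD => i; have [s [sP [e [u [_ esr]]]]] := Hr i.
  case: (primeP i s c) => //; apply: DP.
  have [|w ew] := @prime_toX _ a b m.+1 ab (s * c - b * u).
    exists (e - s * d).
    rewrite (_ : _ * _ = s * r - b ^+ m.+2 * u - a * (s * d)).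
      by rewrite esr; ring.
    by rewrite def_r (exprS b m.+1); ring.
  exists w, u; split=> //; rewrite expr1 -ew; ring.
rewrite def_r; apply: pow2D; last first.
  by rewrite -addn1; apply: pow2M => //; apply: pow2X1; exact: pow2_gen2.
apply: pow2_fst; apply: IHm => i; have [s [sP rs]] := Hr i; exists s; split=> //.
apply: pow2_cancel => //.
rewrite (_ : a * _ = s * r - s * (b ^+ m.+1 * c)); last by rewrite def_r; ring.
apply: pow2B => //; apply: pow2_mull.
by rewrite -addn1; apply: pow2M => //; apply: pow2X1; exact: pow2_gen2.
Qed.

End Pow2.
Arguments pow2 : simpl never.

(** * Sums, products and powers of ideals *)

Section IdealOperations.
Variable R : comNzRingType.
Implicit Types (I J L S : R -> Prop) (a b c r : R).

Lemma ideal_ext I J : eq_ideal I J -> I = J.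
Proof.
by move=> IJ; apply: functional_extensionality => r; apply: propositional_extensionality.
Qed.

Lemma ideal_span_ideal S : is_ideal (ideal_span S).
Proof.
split.
- by exists 0, (fun _ => 0), (fun _ => 0); split; [case | rewrite big_ord0].
- move=> _ _ [k [c [s [Ss ->]]]] [k' [c' [s' [Ss' ->]]]].
  exists (k + k')%N, (fun i => match split i with inl j => c j | inr j => c' j end),
    (fun i => match split i with inl j => s j | inr j => s' j end); split.
    by move=> i; case: (split i).
  rewrite big_split_ord /=; congr (_ + _); apply: eq_bigr => i _.
    by rewrite (unsplitK (inl i)).
  by rewrite (unsplitK (inr i)).
- move=> a _ [k [c [s [Ss ->]]]]; exists k, (fun i => a * c i), s; split=> //.
  by rewrite mulr_sumr; apply: eq_bigr => i _; rewrite mulrA.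
Qed.

Lemma ideal_sum I (T : Type) (s : seq T) (F : T -> R) :
  is_ideal I -> (forall i, I (F i)) -> I (\sum_(i <- s) F i).
Proof. by case=> I0 ID _ IF; apply: (big_ind I). Qed.

Lemma idealB I a b : is_ideal I -> I a -> I b -> I (a - b).
Proof. by case=> _ ID IM Ia Ib; rewrite -mulN1r; apply: ID => //; exact: IM. Qed.

Lemma ideal_span_min S I :
  is_ideal I -> (forall s, S s -> I s) -> sub_ideal (ideal_span S) I.
Proof.
move=> idI SI _ [k [c [s [Ss ->]]]]; apply: ideal_sum => // i.
by case: idI => _ _; apply; apply: SI.
Qed.

Lemma ideal_span_mem S a : S a -> ideal_span S a.
Proof. by exists 1%N, (fun _ => 1), (fun _ => a); split; rewrite // big_ord1 mul1r. Qed.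

Lemma ideal_gen_ideal (s : seq R) : is_ideal (ideal_gen s).
Proof. exact: ideal_span_ideal. Qed.

Lemma ideal_gen_nil r : ideal_gen [::] r <-> r = 0.
Proof.
split=> [[[|k] [c [s [Ss ->]]]]|->]; first by rewrite big_ord0.
  by have := Ss ord0.
by case: (ideal_gen_ideal [::]).
Qed.

Lemma ideal_gen_cons a (s : seq R) r :
  ideal_gen (a :: s) r <-> exists c r', ideal_gen s r' /\ r = c * a + r'.
Proof.
split=> [|[c [r' [sr' ->]]]].
  move: r; apply: ideal_span_min.
    have [s0 sD sM] := ideal_gen_ideal s; split.
    - by exists 0, 0; split=> //; rewrite mul0r addr0.
    - move=> _ _ [c [r [sr ->]]] [c' [r' [sr' ->]]].
      by exists (c + c'), (r + r'); split; [exact: sD | rewrite mulrDl addrACA].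
    move=> b _ [c [r [sr ->]]]; exists (b * c), (b * r).
    by split; [exact: sM | rewrite mulrDr mulrA].
  move=> b; rewrite inE => /orP[/eqP ->|sb].
    by exists 1, 0; split; [case: (ideal_gen_ideal s) | rewrite mul1r addr0].
  by exists 0, b; split; [exact: ideal_span_mem | rewrite mul0r add0r].
have [_ sD sM] := ideal_gen_ideal (a :: s); apply: sD.
  by apply: sM; apply: ideal_span_mem; rewrite mem_head.
move: r' sr'; apply: ideal_span_min => [|b sb]; first exact: ideal_gen_ideal.
by apply: ideal_span_mem; rewrite inE sb orbT.
Qed.

Lemma ideal_gen2 a b r : ideal_gen [:: a; b] r <-> exists c d, r = c * a + d * b.
Proof.
split=> [/ideal_gen_cons [c [_ [/ideal_gen_cons [d [_ [/ideal_gen_nil -> ->]]] ->]]]|[c [d ->]]].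
  by exists c, d; rewrite addr0.
apply/ideal_gen_cons; exists c, (d * b); split=> //; apply/ideal_gen_cons.
by exists d, 0; split; [exact/ideal_gen_nil | rewrite addr0].
Qed.

Lemma ideal_gen3 a b c r :
  ideal_gen [:: a; b; c] r <-> exists u v w, r = u * a + v * b + w * c.
Proof.
split=> [/ideal_gen_cons [u [_ [/ideal_gen2 [v [w ->]] ->]]]|[u [v [w ->]]]].
  by exists u, v, w; rewrite addrA.
apply/ideal_gen_cons; exists u, (v * b + w * c); split; last by rewrite addrA.
by apply/ideal_gen2; exists v, w.
Qed.

Lemma ideal_mul_ideal I J : is_ideal (ideal_mul I J).
Proof. exact: ideal_span_ideal. Qed.

Lemma ideal_mul_mem I J a b : I a -> J b -> ideal_mul I J (a * b).
Proof. by move=> Ia Jb; apply: ideal_span_mem; exists a, b. Qed.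

Lemma ideal_mul_min I J L : is_ideal L ->
  (forall a b, I a -> J b -> L (a * b)) -> sub_ideal (ideal_mul I J) L.
Proof. by move=> idL IJL; apply: ideal_span_min => // _ [a [b [Ia Jb ->]]]; exact: IJL. Qed.

Lemma ideal_mulS I J I' J' : sub_ideal I I' -> sub_ideal J J' ->
  sub_ideal (ideal_mul I J) (ideal_mul I' J').
Proof.
move=> II' JJ'; apply: ideal_mul_min; first exact: ideal_mul_ideal.
by move=> a b /II' Ia /JJ' Jb; exact: ideal_mul_mem.
Qed.

Lemma ideal_mul_subl I J : is_ideal I -> sub_ideal (ideal_mul I J) I.
Proof.
by move=> idI; apply: ideal_mul_min => // a b Ia _; rewrite mulrC; case: idI => _ _; apply.
Qed.

Lemma ideal_exp_ideal I m : is_ideal (ideal_exp I m).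
Proof. by case: m => [|m]; [split | exact: ideal_mul_ideal]. Qed.

Lemma ideal_exp1 I : is_ideal I -> eq_ideal (ideal_exp I 1) I.
Proof.
move=> idI r; split; first exact: ideal_mul_subl.
by move=> Ir; rewrite -(mulr1 r); exact: ideal_mul_mem.
Qed.

Lemma ideal_expX I m r : I r -> ideal_exp I m (r ^+ m).
Proof. by move=> Ir; elim: m => // m IHm; rewrite exprS; exact: ideal_mul_mem. Qed.

Lemma reduction_in_exp L I t k : sub_ideal (ideal_exp I t.+1) (ideal_mul L (ideal_exp I t)) ->
  sub_ideal (ideal_exp I (k + t).+1) (ideal_mul L (ideal_exp I (k + t))).
Proof.
move=> red; elim: k => [|k IHk] //; rewrite addSn.
apply: ideal_mul_min => [|a b Ia /IHk]; first exact: ideal_mul_ideal.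
move: b; apply: ideal_mul_min => [|l b Ll Ib].
  have [I0 ID IM] := ideal_mul_ideal L (ideal_exp I (k + t).+1); split.
  - by rewrite mulr0.
  - by move=> b c *; rewrite mulrDr; exact: ID.
  - by move=> c b *; rewrite mulrCA; exact: IM.
by rewrite mulrCA; apply: ideal_mul_mem => //; exact: ideal_mul_mem.
Qed.

End IdealOperations.

(** * Comparison of ideals after localization at a prime *)

Section Localization.
Variable R : idomainType.
Implicit Types (I p : R -> Prop).
Local Notation "x %:F" := (@FracField.tofrac _ x).

Lemma ideal_exp_pow2 I (a b : R) m : sub_ideal I (pow2 a b 1) ->
  sub_ideal (ideal_exp I m) (pow2 a b m).
Proof.
move=> Iab; elim: m => [|m IHm] //.
apply: ideal_mul_min => [|c d /Iab Ic /IHm Id]; first exact: pow2_ideal.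
exact: (@pow2M _ _ _ 1).
Qed.

(** Where s is invertible I contains (a, b); a degree m form in a, b needs one factor s for each of
    its m linear factors. *)
Lemma pow2_ideal_exp I (a b s : R) m r : is_ideal I ->
  I (s * a) -> I (s * b) -> pow2 a b m r -> ideal_exp I m (s ^+ m * r).
Proof.
move=> idI Ia Ib; elim: m r => // m IHm _ [d [u [dm ->]]].
have [_ ID IM] := ideal_exp_ideal I m.+1; rewrite mulrDr; apply: ID.
  by rewrite exprS mulrACA; apply: ideal_mul_mem => //; exact: IHm.
by rewrite mulrA -exprMn mulrC; apply: IM; exact: ideal_expX.
Qed.

(** Finitely many denominators have a product outside the prime p, so membership in the localization
    becomes a condition in R itself. *)
Lemma contracted_idealP p I r : is_prime_ideal p -> is_ideal I ->
  contracted_ideal p I r <-> exists s, ~ p s /\ I (s * r).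
Proof.
move=> [idp p1 pP] idI; have [I0 ID IM] := idI.
have neq0 s : ~ p s -> s%:F != 0.
  by move=> ps; rewrite tofrac_eq0; apply/eqP => s0; apply: ps; rewrite s0; case: idp.
split=> [[k [c [a [cp aI e]]]]|[s [ps Isr]]]; last first.
  exists 1%N, (fun _ => 1 / s%:F), (fun _ => s * r); split=> //.
    by move=> _; exists 1, s; rewrite tofrac1.
  by rewrite big_ord1 tofracM mul1r mulKf // neq0.
have [s [ps [b [Ib eb]]]] : exists s, ~ p s /\ exists b, I b /\ s%:F * \sum_(i < k) c i * (a i)%:F = b%:F.
  elim: k c a cp aI {e} => [|k IHk] c a cp aI.
    by exists 1; split=> //; exists 0; rewrite big_ord0 mulr0 tofrac0.
  have [|//|s [ps [b [Ib eb]]]] := IHk (fun i => c (lift ord0 i)) (fun i => a (lift ord0 i)); first by [].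
  have [u [v [pv ec]]] := cp ord0.
  exists (v * s); split; first by case/pP.
  exists (s * u * a ord0 + v * b); split; first by apply: ID; exact: IM.
  rewrite big_ord_recl mulrDr tofracD tofracM -[X in _ + X]mulrA eb ec !tofracM.
  congr (_ + _); rewrite -mulrA [RHS]mulrC; field; exact: neq0.
exists s; split=> //; suff -> : s * r = b by [].
by apply/eqP; rewrite -tofrac_eq tofracM e eb.
Qed.

End Localization.

(** * Finitely generated ideals, preparing the determinant trick *)

Section FinitelyGenerated.
Variable R : comNzRingType.
Implicit Types (I J L : R -> Prop) (s : seq R).

Definition finitely_generated I := exists s, I = ideal_gen s.

Lemma ideal_gen_mem s a : a \in s -> ideal_gen s a.
Proof. by move=> sa; apply: ideal_span_mem. Qed.

Lemma ideal_gen_min s I : is_ideal I -> (forall a, a \in s -> I a) -> sub_ideal (ideal_gen s) I.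
Proof. by move=> idI sI; apply: ideal_span_min. Qed.

Lemma finitely_generated1 (a : R) : finitely_generated (fun r => exists c, r = a * c).
Proof.
exists [:: a]; apply: ideal_ext => r; split=> [[c ->]|/ideal_gen_cons [c [_ [/ideal_gen_nil -> ->]]]].
  by apply/ideal_gen_cons; exists c, 0; split; [exact/ideal_gen_nil | rewrite addr0 mulrC].
by exists c; rewrite addr0 mulrC.
Qed.

Lemma finitely_generatedD I J : finitely_generated I -> finitely_generated J ->
  finitely_generated (fun r => exists a b, [/\ I a, J b & r = a + b]).
Proof.
move=> [s ->] [s' ->]; exists (s ++ s'); apply: ideal_ext => r; split.
  have [_ sD _] := ideal_gen_ideal (s ++ s'); move=> [a [b [sa sb ->]]]; apply: sD.
    move: a sa; apply: ideal_gen_min; first exact: ideal_gen_ideal.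
    by move=> a sa; apply: ideal_gen_mem; rewrite mem_cat sa.
  move: b sb; apply: ideal_gen_min; first exact: ideal_gen_ideal.
  by move=> b sb; apply: ideal_gen_mem; rewrite mem_cat sb orbT.
have [s0 sD sM] := ideal_gen_ideal s; have [s'0 s'D s'M] := ideal_gen_ideal s'.
move: r; apply: ideal_gen_min => [|a].
  split; first by exists 0, 0; rewrite addr0.
    move=> _ _ [a [b [sa sb ->]]] [a' [b' [sa' sb' ->]]].
    by exists (a + a'), (b + b'); rewrite addrACA; split; auto.
  move=> c _ [a [b [sa sb ->]]]; exists (c * a), (c * b).
  by rewrite mulrDr; split; auto.
rewrite mem_cat => /orP[] sa; first by exists a, 0; rewrite addr0; split=> //; exact: ideal_gen_mem.
by exists 0, a; rewrite add0r; split=> //; exact: ideal_gen_mem.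
Qed.

Lemma finitely_generatedM I J : finitely_generated I -> finitely_generated J ->
  finitely_generated (ideal_mul I J).
Proof.
move=> [s ->] [s' ->]; exists [seq a * b | a <- s, b <- s'].
apply: ideal_ext => r; split; last first.
  move: r; apply: ideal_gen_min => [|_ /allpairsP[[a b] [/= sa sb ->]]].
    exact: ideal_mul_ideal.
  by apply: ideal_mul_mem; exact: ideal_gen_mem.
have [g0 gD gM] := ideal_gen_ideal [seq a * b | a <- s, b <- s'].
have idl (c : R) : is_ideal (fun r => ideal_gen [seq a * b | a <- s, b <- s'] (r * c)).
  split; first by rewrite mul0r.
    by move=> a b *; rewrite mulrDl; exact: gD.
  by move=> a b *; rewrite -mulrA; exact: gM.
move: r; apply: ideal_mul_min; first exact: ideal_gen_ideal.
move=> a b sa sb; move: a sa; apply: (ideal_gen_min (idl b)) => a sa.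
rewrite mulrC; move: b sb; apply: (ideal_gen_min (idl a)) => b sb.
by apply: ideal_gen_mem; apply/allpairsP; exists (a, b); rewrite mulrC.
Qed.

Lemma finitely_generated_exp I m : finitely_generated I -> finitely_generated (ideal_exp I m).
Proof.
move=> fgI; elim: m => [|m IHm]; last exact: finitely_generatedM.
exists [:: 1]; apply: ideal_ext => r; split=> // _.
by apply/ideal_gen_cons; exists r, 0; split; [exact/ideal_gen_nil | rewrite mulr1 addr0].
Qed.

(** One coefficient per position of s, so that the coefficients can fill the row of a square
    matrix. *)
Lemma ideal_mul_genP L s r : is_ideal L -> ideal_mul L (ideal_gen s) r ->
  exists l : 'I_(size s) -> R, (forall i, L (l i)) /\ r = \sum_i l i * s`_i.
Proof.
move=> [L0 LD LM]; move: r; apply: ideal_mul_min => [|a b La sb].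
  split.
  - by exists (fun _ => 0); split=> //; rewrite big1 // => i _; rewrite mul0r.
  - move=> _ _ [l [Ll ->]] [l' [Ll' ->]]; exists (fun i => l i + l' i).
    split=> [i|]; first exact: LD.
    by rewrite -big_split; apply: eq_bigr => i _; rewrite mulrDl.
  - move=> c _ [l [Ll ->]]; exists (fun i => c * l i); split=> [i|]; first exact: LM.
    by rewrite mulr_sumr; apply: eq_bigr => i _; rewrite mulrA.
move: b sb; apply: ideal_gen_min => [|b sb].
  split.
  - by exists (fun _ => 0); split=> //; rewrite mulr0 big1 // => i _; rewrite mul0r.
  - move=> b b' [l [Ll e]] [l' [Ll' e']]; exists (fun i => l i + l' i).
    split=> [i|]; first exact: LD.
    by rewrite mulrDr e e' -big_split; apply: eq_bigr => i _; rewrite mulrDl.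
  - move=> c b [l [Ll e]]; exists (fun i => c * l i); split=> [i|]; first exact: LM.
    by rewrite mulrCA e mulr_sumr; apply: eq_bigr => i _; rewrite mulrA.
have ib : (index b s < size s)%N by rewrite index_mem.
exists (fun i => if i == Ordinal ib then a else 0); split=> [i|]; first by case: ifP.
rewrite (bigD1 (Ordinal ib)) //= eqxx nth_index // big1 ?addr0 // => i /negPf ->.
by rewrite mul0r.
Qed.

Lemma prod_ideal_exp (T : Type) (s : seq T) (u : T -> R) J :
  (forall i, J (u i)) -> ideal_exp J (size s) (\prod_(i <- s) u i).
Proof.
by move=> Ju; elim: s => [|i s IHs] //; rewrite big_cons; exact: ideal_mul_mem.
Qed.

(** Telescoping, one factor at a time. It compares the terms of two determinants whose entries agree
    modulo L. *)
Lemma prod_sub_ideal (T : Type) (s : seq T) (u v : T -> R) L J :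
  is_ideal L -> (forall i, J (u i)) -> (forall i, J (v i)) -> (forall i, L (u i - v i)) ->
  ideal_mul L (ideal_exp J (size s).-1) (\prod_(i <- s) u i - \prod_(i <- s) v i).
Proof.
move=> idL Ju Jv Luv; elim: s => [|i s IHs].
  by rewrite !big_nil subrr; case: (ideal_mul_ideal L (ideal_exp J 0)).
have [m0 mD mM] := ideal_mul_ideal L (ideal_exp J (size s)).
rewrite !big_cons /= (_ : _ - _ = (u i - v i) * \prod_(j <- s) u j
  + v i * (\prod_(j <- s) u j - \prod_(j <- s) v j)); last by ring.
apply: (mD).
  by apply: ideal_mul_mem => //; exact: prod_ideal_exp.
case: s IHs m0 mD mM => [|j s] IHs m0 mD mM; first by rewrite !big_nil subrr mulr0.
move: (_ - _) IHs; apply: ideal_mul_min => [|l b Ll Jb].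
  split=> [|a b|c a]; rewrite ?mulr0 // ?mulrDr; first exact: mD.
  by rewrite mulrCA; exact: mM.
by rewrite mulrCA; apply: ideal_mul_mem => //; exact: ideal_mul_mem.
Qed.

End FinitelyGenerated.

(** * Integral dependence and analytic independence of a regular pair *)

Section TwoGenerated.
Variable R : idomainType.
Implicit Types (a b p q r v : R) (I J L : R -> Prop).

Lemma finitely_generated_pow2 a b m : finitely_generated (pow2 a b m).
Proof.
elim: m => [|m IHm].
  by exists [:: 1]; apply: ideal_ext => r; split=> // _; apply/ideal_gen_cons; exists r, 0;
    split; [exact/ideal_gen_nil | rewrite mulr1 addr0].
rewrite (_ : pow2 a b m.+1 = fun r => exists c d,
  [/\ ideal_mul (fun r => exists c, r = a * c) (pow2 a b m) c,
      (exists e, d = b ^+ m.+1 * e) & r = c + d]); last first.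
  apply: ideal_ext => r; split=> [[d [s [dm ->]]]|[c [_ [cm [s ->] ->]]]].
    exists (a * d), (b ^+ m.+1 * s); split=> //; last by exists s.
    by apply: ideal_mul_mem => //; exists 1; rewrite mulr1.
  apply: pow2D; last by apply: pow2_mulr; apply: pow2X1; exact: pow2_gen2.
  move: c cm; apply: ideal_mul_min => [|_ d [c ->] dm]; first exact: pow2_ideal.
  by rewrite -mulrA; apply: pow2_fst; exact: pow2_mull.
apply: finitely_generatedD; last exact: finitely_generated1.
by apply: finitely_generatedM => //; exact: finitely_generated1.
Qed.

(** Multiplication by a acts on generators of I through a matrix with entries in L. The matrix M, a
    times the identity minus it, kills a nonzero column, so over a domain its determinant is 0.
    Expanding det(a) - det(M) over permutations puts a^(k+1) in L J^k, where k + 1 is the number of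
    generators. *)
Lemma determinant_trick I L J a : finitely_generated I -> (exists2 b, I b & b != 0) ->
  is_ideal L -> sub_ideal L J -> is_ideal J -> J a ->
  (forall b, I b -> ideal_mul L I (a * b)) ->
  exists k, ideal_mul L (ideal_exp J k) (a ^+ k.+1).
Proof.
move=> [s ->] [b0 sb0 b0_neq0] idL LJ idJ Ja aI.
have [i0 si0] : exists i : 'I_(size s), s`_i != 0.
  apply: NNPP => Ns; case/negP: b0_neq0; apply/eqP.
  move: b0 sb0; apply: (@ideal_gen_min _ s (fun b => b = 0)).
    by split=> // [? ? -> ->|c ? ->]; rewrite ?addr0 ?mulr0.
  move=> b sb; apply: NNPP => /eqP b_neq0; apply: Ns.
  have ib : (index b s < size s)%N by rewrite index_mem.
  by exists (Ordinal ib); rewrite /= nth_index.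
have /fin_all_exists [l ll] (i : 'I_(size s)) : exists l : 'I_(size s) -> R,
    (forall j, L (l j)) /\ a * s`_i = \sum_j l j * s`_j.
  by apply: ideal_mul_genP => //; apply: aI; apply: ideal_gen_mem; rewrite mem_nth.
pose M := a%:M - \matrix_(i, j) l i j.
have M0 : M *m (\col_i s`_i) = 0.
  apply/matrixP => i j; rewrite mulmxBl mul_scalar_mx !mxE.
  have [_ ->] := ll i; rewrite -sumrB big1 // => k _.
  by rewrite !mxE subrr.
have dM : \det M = 0.
  have := congr1 (mulmx (\adj M)) M0; rewrite mulmxA mul_adj_mx mulmx0 mul_scalar_mx.
  move/matrixP/(_ i0 ord0); rewrite !mxE => /eqP.
  by rewrite mulf_eq0 (negPf si0) orbF => /eqP.
have [k sk] : exists k, size s = k.+1 by case: (size s) i0 {si0 M M0 dM l ll} => [[]//|k]; exists k.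
exists k; have idLJ := ideal_mul_ideal L (ideal_exp J k).
have -> : a ^+ k.+1 = \det (a%:M : 'M[R]_(size s)) - \det M.
  by rewrite dM subr0 det_scalar sk.
rewrite /determinant -sumrB.
apply: (@ideal_sum _ (ideal_mul L (ideal_exp J k))) => // t.
rewrite -mulrBr; case: (idLJ) => L0 LD LM; apply: LM.
have := @prod_sub_ideal R _ (index_enum 'I_(size s)) (fun i => (a%:M : 'M_(size s)) i (t i))
  (fun i => M i (t i)) L J idL.
have -> : size (index_enum 'I_(size s)) = k.+1 by rewrite [index_enum _]unlock -enumT size_enum_ord.
have J0 : J 0 by case: idJ.
have Ja' i j : J ((a%:M : 'M_(size s)) i j) by rewrite mxE; case: (i == j).
apply=> // i; rewrite !mxE.
  by apply: idealB => //; first (by have := Ja' i (t i); rewrite mxE); apply: LJ; case: (ll i).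
by rewrite opprB addrC subrK; case: (ll i).
Qed.

(* [pow2_value a b p q m r v]: some form of degree m in (a, b) representing r
   takes the value v at (p, q). *)
Fixpoint pow2_value a b p q m r v : Prop :=
  if m is m'.+1 then exists d s w, [/\ pow2_value a b p q m' d w,
    r = a * d + b ^+ m * s & v = p * w + q ^+ m * s]
  else v = r.

Section Value.
Variables a b p q : R.
Local Notation value := (pow2_value a b p q).

Lemma pow2_value_exists m r : pow2 a b m r -> exists v, value m r v.
Proof.
elim: m r => [|m IHm] r; first by exists r.
by case=> d [s [/IHm[w dw] ->]]; exists (p * w + q ^+ m.+1 * s), d, s, w.
Qed.

Lemma pow2_valueD m r v r' v' : value m r v -> value m r' v' -> value m (r + r') (v + v').
Proof.
elim: m r v r' v' => [|m IHm] r v r' v'; first by move=> /= -> ->.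
move=> [d [s [w [dw -> ->]]]] [d' [s' [w' [dw' -> ->]]]].
by exists (d + d'), (s + s'), (w + w'); split; [exact: IHm | ring | ring].
Qed.

Lemma pow2_valueZ m c r v : value m r v -> value m (c * r) (c * v).
Proof.
elim: m r v => [|m IHm] r v; first by move=> /= ->.
move=> [d [s [w [dw -> ->]]]].
by exists (c * d), (c * s), (c * w); split; [exact: IHm | ring | ring].
Qed.

Lemma pow2_value_fst m r v : value m r v -> value m.+1 (a * r) (p * v).
Proof. by move=> rv; exists r, 0, v; rewrite !mulr0 !addr0. Qed.

Lemma pow2_value_snd m r v : value m r v -> value m.+1 (b * r) (q * v).
Proof.
elim: m r v => [|m IHm] r v.
  by move=> /= ->; exists 0, r, 0; rewrite !mulr0 !add0r !expr1.
move=> [d [s [w [/IHm dw -> ->]]]]; exists (b * d), s, (q * w).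
by rewrite (exprS b m.+1) (exprS q m.+1); split; [| ring | ring].
Qed.

Lemma pow2_value_fstX m : value m (a ^+ m) (p ^+ m).
Proof. by elim: m => [|m IHm] //; rewrite !exprS; exact: pow2_value_fst. Qed.

Lemma pow2_value_sndX m : value m (b ^+ m) (q ^+ m).
Proof. by elim: m => [|m IHm] //; rewrite !exprS; exact: pow2_value_snd. Qed.

(* (a, b) is quasi-regular, so values are well defined modulo (a, b). *)
Lemma pow2_value0 m v : a != 0 -> prime_to a b -> value m 0 v -> pow2 a b 1 v.
Proof.
move=> a0 ab; elim: m v => [|m IHm] v; first by move=> /= ->; exact: pow2_0.
move=> [d [s [w [dw e ->]]]].
have [|s' es] := @prime_toX _ a b m.+1 ab s.
  by exists (- d); rewrite mulrN; apply/eqP; rewrite -addr_eq0 addrC -e.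
have ed : d = - b ^+ m.+1 * s'.
  apply: (mulfI a0); apply/eqP; rewrite -subr_eq0 {1}e es; apply/eqP; ring.
have : value m 0 (w + q ^+ m * (b * s')).
  have -> : 0 = d + b * s' * b ^+ m by rewrite ed exprS; ring.
  apply: pow2_valueD => //; rewrite (mulrC (q ^+ m)).
  by apply: pow2_valueZ; exact: pow2_value_sndX.
move/IHm => wP; rewrite es.
apply: pow2D; last by apply: pow2_mull; apply: pow2_mulr; exact: pow2_gen1.
apply: pow2_mull; rewrite -[w](addrK (q ^+ m * (b * s'))).
by apply: pow2B => //; apply: pow2_mull; apply: pow2_mulr; exact: pow2_gen2.
Qed.

Lemma pow2_value_unique m r v v' : a != 0 -> prime_to a b ->
  value m r v -> value m r v' -> pow2 a b 1 (v - v').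
Proof.
move=> a0 ab rv /(pow2_valueZ (-1)) rv'; apply: (@pow2_value0 m) => //.
by rewrite -[v - v']/(v + - v') -(mulN1r v') -(subrr r) -(mulN1r r); exact: pow2_valueD.
Qed.

(** An element of L is represented by linear forms, whose values lie in V by hypothesis; multiplying
    by a form of degree m multiplies the value, which stays in the ideal V. *)
Lemma pow2_value_mul L V m r : is_ideal V -> sub_ideal L (pow2 a b 1) ->
  (forall c d, L (c * a + d * b) -> V (c * p + d * q)) ->
  ideal_mul L (pow2 a b m) r -> exists v, V v /\ value m.+1 r v.
Proof.
move=> [V0 VD VM] Lab LV; move: r; apply: ideal_mul_min => [|l j Ll jm].
  split.
  - exists 0; split=> //; rewrite -[X in value _ X _](mul0r 0) -[X in value _ _ X](mul0r (0 * p ^+ m.+1)).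
    have := pow2_valueZ 0 (pow2_value_fstX m.+1); rewrite !mul0r; exact.
  - move=> r s [v [Vv rv]] [w [Vw sw]]; exists (v + w).
    by split; [exact: VD | exact: pow2_valueD].
  - by move=> c r [v [Vv rv]]; exists (c * v); split; [exact: VM | exact: pow2_valueZ].
have [w jw] := pow2_value_exists jm.
have [c [d [_ el]]] := Lab _ Ll; exists (w * (c * p + d * q)); split.
  by apply: VM; apply: LV; rewrite -(_ : l = c * a + d * b) // el expr1; ring.
rewrite el expr1 (_ : _ * j = c * (a * j) + d * (b * j)); last by ring.
rewrite (_ : w * _ = c * (p * w) + d * (q * w)); last by ring.
by apply: pow2_valueD; apply: pow2_valueZ; [exact: pow2_value_fst | exact: pow2_value_snd].
Qed.

End Value.

(* Two generators forming a regular sequence are analytically independent, so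
   no smaller ideal can have them integral over it. *)
Lemma regular_pair_basic a b L i j : a != 0 -> prime_to a b ->
  is_ideal L -> sub_ideal L (pow2 a b 1) ->
  ideal_mul L (pow2 a b i) (a ^+ i.+1) -> ideal_mul L (pow2 a b j) (b ^+ j.+1) ->
  L a /\ L b.
Proof.
move=> a0 ab idL Lab aL bL; have [L0 LD LM] := idL.
(* V is the ideal (a, b) + (L : (a, b)). The aim is to show that it contains 1. *)
pose V r := exists e, [/\ pow2 a b 1 e, L ((r - e) * a) & L ((r - e) * b)].
have idV : is_ideal V.
  split.
  - by exists 0; rewrite subrr !mul0r; split=> //; exact: pow2_0.
  - move=> r s [e [eP ra rb]] [e' [eP' sa sb]]; exists (e + e').
    have dist t : (r + s - (e + e')) * t = (r - e) * t + (s - e') * t by ring.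
    by rewrite !dist; split; [exact: pow2D | exact: LD | exact: LD].
  - move=> c r [e [eP ra rb]]; exists (c * e).
    by rewrite -mulrBr -!mulrA; split; [exact: pow2_mull | exact: LM | exact: LM].
have [V0 VD VM] := idV.
have VJ e : pow2 a b 1 e -> V e by exists e; rewrite subrr !mul0r.
have minors c d c' d' : L (c * a + d * b) -> L (c' * a + d' * b) -> V (c' * d + d' * - c).
  move=> l l'; exists 0; rewrite subr0; split; first exact: pow2_0.
    rewrite (_ : _ * a = d * (c' * a + d' * b) - d' * (c * a + d * b)); last by ring.
    by apply: idealB => //; exact: LM.
  rewrite (_ : _ * b = c' * (c * a + d * b) - c * (c' * a + d' * b)); last by ring.
  by apply: idealB => //; exact: LM.
have Vcongr v w : pow2 a b 1 (v - w) -> V w -> V v.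
  by move=> /VJ vw Vw; rewrite -(subrK w v); exact: VD.
(* At the point (d, -c) the linear forms of elements of L become 2 x 2 minors, which V contains,
   whereas b^(j+1) takes the value (-c)^(j+1). Hence c is nilpotent modulo V. *)
have nilp c d : L (c * a + d * b) -> V (c ^+ j.+1).
  move=> l; have LV c' d' := @minors c d c' d' l.
  have [w [Vw bw]] := pow2_value_mul idV Lab LV bL.
  have := pow2_value_unique a0 ab (pow2_value_sndX a b d (- c) j.+1) bw.
  by move/Vcongr/(_ Vw) => /(VM ((-1) ^+ j.+1)); rewrite -exprMn mulN1r opprK.
pose rad r := exists k, V (r ^+ k).
have id_rad : is_ideal rad.
  split; first by exists 1%N; rewrite expr1.
    move=> r s [k rk] [l sl]; exists (k + l)%N.
    have rs : pow2 r s (k + l) ((r + s) ^+ (k + l)).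
      by apply: pow2X1; apply: pow2D; [exact: pow2_gen1 | exact: pow2_gen2].
    have [d [t [_ _ ->]]] := pow2_split rs; apply: VD; first by rewrite mulrC; exact: VM.
    by rewrite exprS mulrAC; exact: VM.
  by move=> c r [k rk]; exists k; rewrite exprMn; exact: VM.
have rad1 c d : L (c * a + d * b) -> rad (c * 1 + d * 0).
  by rewrite mulr1 mulr0 addr0 => /nilp; exists j.+1.
(* At the point (1, 0) the linear forms of L take values in the radical of V, while a^(i+1) takes
   the value 1. *)
have [w [rw aw]] := pow2_value_mul id_rad Lab rad1 aL.
have [e [eP ea eb]] : V 1.
  have := pow2_value_unique a0 ab (pow2_value_fstX a b 1 0 i.+1) aw.
  rewrite expr1n => /VJ w1; have [_ radD _] := id_rad.
  have [|k] := radD (1 - w) w _ rw; first by exists 1%N.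
  by rewrite subrK expr1n.
have Le : L (e ^+ (i.+1 + j.+1)).
  have [d [s [_ _ ->]]] := pow2_split (pow2X1 (i.+1 + j.+1) eP).
  have sub k r : ideal_mul L (pow2 a b k) r -> L r by exact: ideal_mul_subl.
  apply: LD; first by rewrite mulrC; apply: LM; exact: sub aL.
  by rewrite exprS mulrAC; apply: (LM); exact: sub bL.
(* 1 - e divides 1 - e^N with e^N in L, so 1 - e cancels modulo L although it need not be a unit of
   R. *)
have unit_L c : L ((1 - e) * c) -> L c.
  move=> ec; rewrite -[c]mul1r -(subrK (e ^+ (i.+1 + j.+1)) 1) mulrDl; apply: LD.
    by rewrite -{1}(expr1n _ (i.+1 + j.+1)) subrXX mulrAC mulrC; exact: LM.
  by rewrite mulrC; exact: LM.
by split; exact: unit_L.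
Qed.

End TwoGenerated.

Lemma pow2_morph (R : idomainType) (rho : {rmorphism R -> R}) (a b : R) m r :
  pow2 a b m r -> pow2 (rho a) (rho b) m (rho r).
Proof.
elim: m r => // m IHm _ [d [u [/IHm dm ->]]].
by exists (rho d), (rho u); split=> //; rewrite rmorphD !rmorphM rmorphXn.
Qed.

Lemma rmorph_eq1_neq0 (R : nzRingType) (rho : {rmorphism R -> R}) b :
  rho b = 1 -> b != 0.
Proof.
move=> rb; apply/eqP => b0; have := oner_neq0 R.
by rewrite -rb b0 rmorph0 eqxx.
Qed.

(** * Fermat forms over a polynomial ring with abstract coordinates *)

Section Coordinates.
Variables (K : fieldType) (R : idomainType) (iota : {rmorphism K -> R}).

(* An abstract polynomial ring K[x, y, z], up to permutation of the variables:
   substitutions exist, and r(x, y, z) - r(a, b, c) lies in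
   (x - a, y - b, z - c). *)
Definition coordinates (x y z : R) := forall a b c, exists rho : {rmorphism R -> R},
  [/\ rho x = a, rho y = b, rho z = c, (forall k, rho (iota k) = iota k)
    & forall r, exists u v w,
        r - rho r = u * (x - a) + v * (y - b) + w * (z - c)].

Lemma coordinates_cyc x y z : coordinates x y z -> coordinates y z x.
Proof.
move=> co a b c; have [rho [rx ry rz ri rr]] := co c a b.
exists rho; split=> // r; have [u [v [w ->]]] := rr r.
by exists v, w, u; ring.
Qed.

Variables (n : nat) (W : seq K).
Hypothesis n_ge3 : (3 <= n)%N.
Hypothesis sizeW : size W = n.
Hypothesis fermat_factor :
  forall y z : R, y ^+ n - z ^+ n = \prod_(w <- W) (y - iota w * z).

Definition fermat (y z : R) := y ^+ n - z ^+ n.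

Section Axes.
Variables x y z : R.
Hypothesis co : coordinates x y z.
Let n_gt0 : (0 < n)%N. Proof. exact: leq_trans n_ge3. Qed.
Let expr0n_gt0 : 0 ^+ n = 0 :> R.
Proof. by rewrite expr0n; case: n n_gt0. Qed.

Lemma coord_neq0 : x != 0.
Proof. by have [rho [rx _ _ _ _]] := co 1 0 0; exact: rmorph_eq1_neq0 rx. Qed.

Lemma fermat_neq0 : fermat y z != 0.
Proof.
have [rho [_ ry rz _ _]] := co 0 1 0; apply: (@rmorph_eq1_neq0 _ rho).
by rewrite rmorphB !rmorphXn ry rz expr0n_gt0 expr1n subr0.
Qed.

Lemma linear_neq0 w : y - iota w * z != 0.
Proof.
have [rho [_ ry rz _ _]] := co 0 1 0; apply: (@rmorph_eq1_neq0 _ rho).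
by rewrite rmorphB rmorphM ry rz mulr0 subr0.
Qed.

(** rho substitutes w z for y and fixes x and z, so its kernel is generated by the linear form y - w
    z; since R is a domain, b cancels as soon as its image is nonzero. *)
Lemma prime_to_linear w (rho : {rmorphism R -> R}) b :
    rho x = x -> rho y = iota w * z -> rho z = z ->
    (forall k, rho (iota k) = iota k) ->
    (forall r, exists u v t,
       r - rho r = u * (x - x) + v * (y - iota w * z) + t * (z - z)) ->
  rho b != 0 -> prime_to (y - iota w * z) b.
Proof.
move=> rx ry rz ri rr b0 r [c e].
have rr0 : rho r = 0.
  apply: (mulfI b0); rewrite -rmorphM e rmorphM rmorphB ry rmorphM ri rz.
  by rewrite subrr mul0r mulr0.
by have [u [v [t]]] := rr r; rewrite rr0 => e'; exists v; rewrite -[r]subr0 e'; ring.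
Qed.

Lemma prime_to_linear_fermat w : prime_to (y - iota w * z) (fermat z x).
Proof.
have [rho [rx ry rz ri rr]] := co x (iota w * z) z.
apply: (prime_to_linear rx ry rz ri rr).
have [sig [sx _ sz _ _]] := co 0 0 1; apply: (@rmorph_eq1_neq0 _ sig).
by rewrite rmorphB !rmorphXn rx rz rmorphB !rmorphXn sx sz expr0n_gt0 expr1n subr0.
Qed.

Lemma prime_to_linear_last w : prime_to (y - iota w * z) z.
Proof.
have [rho [rx ry rz ri rr]] := co x (iota w * z) z.
apply: (prime_to_linear rx ry rz ri rr); rewrite rz.
by have [sig [_ _ sz _ _]] := co 0 0 1; exact: rmorph_eq1_neq0 sz.
Qed.

Lemma prime_to_fermat : prime_to (fermat y z) (fermat z x).
Proof.
rewrite {1}/fermat fermat_factor; apply: prime_to_prod => w.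
  exact: linear_neq0.
exact: prime_to_linear_fermat.
Qed.

Lemma prime_to_fermat_last : prime_to (fermat y z) z.
Proof.
rewrite /fermat fermat_factor; apply: prime_to_prod => w.
  exact: linear_neq0.
exact: prime_to_linear_last.
Qed.

Lemma prime_to_fermat' : prime_to (fermat y z) (fermat x y).
Proof.
apply: (@prime_to_congr _ _ _ (- fermat z x)).
  by exists (-1); rewrite /fermat; ring.
exact: prime_toN prime_to_fermat.
Qed.

Lemma prime_to_yz : prime_to y z.
Proof.
have [rho [rx ry rz ri rr]] := co x 0 z.
have z0 : z != 0.
  by have [sig [_ _ sz _ _]] := co 0 0 1; exact: rmorph_eq1_neq0 sz.
move=> r [c e].
have rr0 : rho r = 0 by apply: (mulfI z0); rewrite -{1}rz -rmorphM e rmorphM ry mul0r mulr0.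
by have [u [v [t]]] := rr r; rewrite rr0 => e'; exists v; rewrite -[r]subr0 e'; ring.
Qed.

Lemma axis_ideal : exists rho : {rmorphism R -> R},
  [/\ rho x = x, rho y = 0, rho z = 0
    & forall r, pow2 y z 1 r <-> rho r = 0].
Proof.
have [rho [rx ry rz ri rr]] := co x 0 0.
exists rho; split=> // r; split=> [[d [s [_ ->]]]|r0].
  by rewrite expr1 rmorphD !rmorphM ry rz !mul0r addr0.
have [u [v [t]]] := rr r; rewrite r0 subr0 => ->.
by exists v, t; split=> //; rewrite expr1; ring.
Qed.

Lemma axis_prime c d : pow2 y z 1 (c * d) -> pow2 y z 1 c \/ pow2 y z 1 d.
Proof.
have [rho [_ _ _ rP]] := axis_ideal.
move/rP; rewrite rmorphM => /eqP; rewrite mulf_eq0 => /orP[] /eqP /rP; by auto.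
Qed.

Lemma y_neq0 : y != 0.
Proof.
by have [sig [_ sy _ _ _]] := co 0 1 0; exact: rmorph_eq1_neq0 sy.
Qed.

Lemma axis_primary k s r :
  ~ pow2 y z 1 s -> pow2 y z k (s * r) -> pow2 y z k r.
Proof.
move=> sP rs; apply: (@pow2_primary _ unit (fun _ => pow2 y z 1)) => //.
- exact: y_neq0.
- exact: prime_to_yz.
- by move=> c /(_ tt).
- by move=> _; exact: axis_prime.
by move=> _; exists s.
Qed.

Lemma axisNx : ~ pow2 y z 1 x.
Proof.
have [rho [rx _ _ rP]] := axis_ideal; move/rP/eqP.
by rewrite rx; apply/negP; exact: coord_neq0.
Qed.

Lemma axisNg : ~ pow2 y z 1 (fermat z x).
Proof.
have [rho [rx _ rz rP]] := axis_ideal; move/rP/eqP.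
rewrite rmorphB !rmorphXn rx rz expr0n_gt0 sub0r oppr_eq0.
by apply/negP; rewrite expf_neq0 // coord_neq0.
Qed.

Lemma axisNh : ~ pow2 y z 1 (fermat x y).
Proof.
have [rho [rx ry _ rP]] := axis_ideal; move/rP/eqP.
rewrite rmorphB !rmorphXn rx ry expr0n_gt0 subr0.
by apply/negP; rewrite expf_neq0 // coord_neq0.
Qed.

Lemma axisX k s : ~ pow2 y z 1 s -> ~ pow2 y z 1 (s ^+ k).
Proof.
have [rho [_ _ _ rP]] := axis_ideal.
move=> sP /rP; rewrite rmorphXn => /eqP; rewrite expf_eq0 => /andP[_ /eqP]/rP.
exact: sP.
Qed.

Lemma fermat_axis : pow2 y z n (fermat y z).
Proof.
by apply: pow2B; apply: pow2X1; [exact: pow2_gen1 | exact: pow2_gen2].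
Qed.

(** f is a product of n linear forms l in y and z. Each l may replace y as a generator of (y, z),
    and cancelling it costs one in the exponent. *)
Lemma axis_cancel m r : pow2 y z (n + m) (fermat y z * r) -> pow2 y z m r.
Proof.
rewrite /fermat fermat_factor -sizeW.
elim: W r => [|w s IHs] r; first by rewrite big_nil mul1r.
rewrite big_cons [size _]/= addSn -mulrA => H; apply: IHs; move: H.
set l := y - iota w * z.
have sub1 k c : pow2 y z k c -> pow2 l z k c.
  apply: pow2_sub; last exact: pow2_gen2.
  rewrite (_ : y = l + iota w * z); last by rewrite /l; ring.
  by apply: pow2D; [exact: pow2_gen1 | apply: pow2_mull; exact: pow2_gen2].
have sub2 k c : pow2 l z k c -> pow2 y z k c.
  apply: pow2_sub; last exact: pow2_gen2.
  by apply: pow2B; [exact: pow2_gen1 | apply: pow2_mull; exact: pow2_gen2].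
move/sub1/pow2_cancel => H; apply: sub2; apply: H; first exact: linear_neq0.
exact: prime_to_linear_last.
Qed.

Let mod_axis k r := exists p t, pow2 y z k p /\ r = p + fermat y z * t.

Let mod_axisD k r s : mod_axis k r -> mod_axis k s -> mod_axis k (r + s).
Proof.
move=> [p [t [pk ->]]] [p' [t' [pk' ->]]]; exists (p + p'), (t + t').
by split; [exact: pow2D | ring].
Qed.

Let mod_axis_mull k c r : mod_axis k r -> mod_axis k (c * r).
Proof.
move=> [p [t [pk ->]]]; exists (c * p), (c * t).
by split; [exact: pow2_mull | ring].
Qed.

(* Substituting 0 for [x] fixes (y, z) and [fermat y z], so that [x] can be
   cancelled modulo (y, z)^k + (fermat y z). *)
Let mod_axis_cancel_x k r : mod_axis k (x * r) -> mod_axis k r.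
Proof.
have [rho [rx ry rz ri rr]] := co 0 y z => -[p [t [pk e]]].
have rf : rho (fermat y z) = fermat y z by rewrite rmorphB !rmorphXn ry rz.
have [p1 [v1 [w1 ep]]] := rr p; have [t1 [v2 [w2 et]]] := rr t.
have x0 := coord_neq0.
have e0 : 0 = rho p + fermat y z * rho t.
  by rewrite -[in fermat _ _]rf -rmorphM -rmorphD -e rmorphM rx mul0r.
exists p1, t1; split.
  apply: (axis_primary axisNx).
  rewrite (_ : x * p1 = p - rho p); last by rewrite ep; ring.
  apply: pow2B => //; rewrite -{1}ry -{1}rz; exact: pow2_morph.
apply: (mulfI x0); rewrite e -[RHS]addr0 [X in _ = _ + X]e0.
move: (rho p) (rho t) ep et => p0 t0 /eqP; rewrite subr_eq => /eqP -> /eqP.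
by rewrite subr_eq => /eqP ->; ring.
Qed.

(** If g r is zero modulo (y, z)^k + (f), then x^n and z^n act alike on r, hence so do x^(nk) and
    z^(nk). The latter lies in (y, z)^k, so x^(nk) kills r, and x cancels. *)
Let mod_axis_cancel_g k r : mod_axis k (fermat z x * r) -> mod_axis k r.
Proof.
move=> gr.
have xz j : mod_axis k (x ^+ (n * j) * r - z ^+ (n * j) * r).
  rewrite -mulrBl !exprM subrXX -mulrA mulrCA mulrC -mulrA.
  rewrite (_ : _ * _ = - (\sum_(i < j) (x ^+ n) ^+ (j.-1 - i) * (z ^+ n) ^+ i) * (fermat z x * r)).
    exact: mod_axis_mull.
  by rewrite /fermat; ring.
have zr : mod_axis k (z ^+ (n * k) * r).
  exists (z ^+ (n * k) * r), 0; split; last by rewrite mulr0 addr0.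
  apply: pow2_mulr; apply: (@pow2W _ _ _ (n * k)); first exact: leq_pmull.
  by apply: pow2X1; exact: pow2_gen2.
have := mod_axisD (xz k) zr; rewrite subrK.
elim: (n * k)%N => [|j IHj]; first by rewrite mul1r.
by rewrite exprS -mulrA => /mod_axis_cancel_x.
Qed.

(** Modulo f only g^m c is left of r, and r itself witnesses that g^m c lies in (y, z)^k + (f).
    Powers of g cancel there, so c is in (y, z)^k up to a multiple of f. *)
Lemma fermat_mod m k r :
  pow2 (fermat y z) (fermat z x) m r -> pow2 y z k r ->
  exists a, pow2 y z k a /\ divides (fermat y z) (r - fermat z x ^+ m * a).
Proof.
move=> /pow2_mod_fst [c [t e]] rk.
have : mod_axis k (fermat z x ^+ m * c).
  by exists r, (- t); split=> //; rewrite mulrN -e; ring.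
have gX j s : mod_axis k (fermat z x ^+ j * s) -> mod_axis k s.
  elim: j => [|j IHj]; first by rewrite mul1r.
  by rewrite exprS -mulrA => /mod_axis_cancel_g.
move/gX => [a [u [ak ec]]]; exists a; split=> //.
exists (t + fermat z x ^+ m * u); rewrite mulrDr -e ec; ring.
Qed.

(** An element of (y, z)^(2n) is y^n d + z^(n+1) s, and y^n = z^n modulo f lets z^n be factored
    out. *)
Lemma fermat_mod2 m r :
  pow2 (fermat y z) (fermat z x) m r -> pow2 y z (n + n) r ->
  exists a, pow2 y z n a /\ divides (fermat y z) (r - fermat z x ^+ m * (z ^+ n * a)).
Proof.
move=> rD /(fermat_mod rD) [c [/pow2_split [d [s [dn sn ec]]] [t e]]].
exists (d + z * s); split.
  apply: pow2D => //; case: n n_gt0 sn => // k _ sk; exact: pow2_snd.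
exists (t + fermat z x ^+ m * d).
rewrite [RHS]mulrDr -e ec (exprS z n); move: (_ ^+ m) => gm.
by rewrite /fermat; ring.
Qed.

Lemma pow2_fermat_cyc m r :
  pow2 (fermat y z) (fermat z x) m r -> pow2 (fermat z x) (fermat x y) m r.
Proof.
apply: pow2_sub; last exact: pow2_gen1.
rewrite (_ : fermat y z = - fermat z x - fermat x y); last by rewrite /fermat; ring.
apply: pow2B; last exact: pow2_gen2.
by apply: pow2N; exact: pow2_gen1.
Qed.

Lemma pow2_fermat_cancel m r :
  pow2 (fermat y z) (fermat z x) m.+1 (fermat y z * r) ->
  pow2 (fermat y z) (fermat z x) m r.
Proof. exact: pow2_cancel fermat_neq0 prime_to_fermat. Qed.
End Axes.

(** The exponents are separate because division by f g h treats them differently: (2n, 2n) becomes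
    (2n - 3, n). *)
Definition fermat_pow (x y z : R) m k r :=
  [/\ pow2 (fermat y z) (fermat z x) m r, pow2 y z k r, pow2 z x k r & pow2 x y k r].

Lemma fermat_pow_cyc x y z m k r : fermat_pow x y z m k r -> fermat_pow y z x m k r.
Proof. by case=> /pow2_fermat_cyc rD r1 r2 r3; split. Qed.

Lemma fermat_pow0 x y z m k : fermat_pow x y z m k 0.
Proof. by split; exact: pow2_0. Qed.

Lemma fermat_powD x y z m k r s :
  fermat_pow x y z m k r -> fermat_pow x y z m k s -> fermat_pow x y z m k (r + s).
Proof. by case=> r0 r1 r2 r3 [s0 s1 s2 s3]; split; exact: pow2D. Qed.

Lemma fermat_pow_mull x y z m k c r :
  fermat_pow x y z m k r -> fermat_pow x y z m k (c * r).
Proof. by case=> r0 r1 r2 r3; split; exact: pow2_mull. Qed.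

Lemma fermat_powM x y z m k m' k' r s :
  fermat_pow x y z m k r -> fermat_pow x y z m' k' s ->
  fermat_pow x y z (m + m') (k + k') (r * s).
Proof. by case=> r0 r1 r2 r3 [s0 s1 s2 s3]; split; exact: pow2M. Qed.

(** For n = 3 the exponent n - 2 is 1, so this one formula covers both cases of the theorem. *)
Definition third_gen (x y z : R) :=
  fermat z x ^+ (n - 2) * fermat y z ^+ 2 * x ^+ n
  + fermat x y ^+ (n - 2) * fermat z x ^+ 2 * y ^+ n
  + fermat y z ^+ (n - 2) * fermat x y ^+ 2 * z ^+ n.

Lemma third_gen_cyc x y z : third_gen y z x = third_gen x y z.
Proof. by rewrite /third_gen; ring. Qed.

Section Parts.
Variables x y z : R.
Hypothesis co : coordinates x y z.
Let co' := coordinates_cyc co.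
Let co'' := coordinates_cyc co'.
Local Notation f := (fermat y z).
Local Notation g := (fermat z x).
Local Notation h := (fermat x y).
Let n_gt0 : (0 < n)%N. Proof. exact: leq_trans n_ge3. Qed.
Let gX : g ^+ n = g * g ^+ n.-1. Proof. by rewrite -exprS prednK. Qed.
Let h_def : h = - g - f. Proof. by rewrite /fermat; ring. Qed.
Let f_D : pow2 f g 1 f. Proof. exact: pow2_gen1. Qed.
Let g_D : pow2 f g 1 g. Proof. exact: pow2_gen2. Qed.
Let h_D : pow2 f g 1 h.
Proof. by rewrite h_def; apply: pow2B => //; apply: pow2N. Qed.

(** Only the middle term survives modulo f, as n - 2 > 0. There h = -g and y^n = z^n, so it equals
    (-g)^(n-2) g^2 z^n. *)
Lemma third_gen_mod :
  divides f (third_gen x y z - (-1) ^+ n * g ^+ n * z ^+ n).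
Proof.
have -> : third_gen x y z - (-1) ^+ n * g ^+ n * z ^+ n =
   f * (g ^+ (n - 2) * f * x ^+ n + f ^+ (n - 3) * h ^+ 2 * z ^+ n
        + h ^+ (n - 2) * g ^+ 2)
   + (h ^+ (n - 2) - (- g) ^+ (n - 2)) * (g ^+ 2 * z ^+ n).
  have -> : (-1) ^+ n * g ^+ n = (- g) ^+ (n - 2) * g ^+ 2.
    by rewrite -exprNn -sqrrN -exprD subnK // ltnW.
  rewrite /third_gen (_ : f ^+ (n - 2) = f ^+ (n - 3) * f); last first.
    by rewrite -exprSr subnSK.
  move: (g ^+ _) (h ^+ (n - 2)) ((- g) ^+ _) (f ^+ (n - 3)) => a b c d.
  have -> : y ^+ n = f + z ^+ n by rewrite /fermat; ring.
  by ring.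
apply: dividesD; first by apply: divides_mulr; exact: divides_refl.
by apply: divides_mulr; rewrite subrXX; apply: divides_mulr; exists (-1); rewrite h_def; ring.
Qed.

(** On each axis one summand contains the square of the form vanishing there to order n, and the
    other two contain the n-th power of a vanishing variable. For D the exponents add up as (n - 2)
    + 2. *)
Lemma third_gen_pow : fermat_pow x y z n n (third_gen x y z).
Proof.
have D3 (a b c d : R) : pow2 f g 1 a -> pow2 f g 1 b -> pow2 f g n (a ^+ (n - 2) * b ^+ 2 * c).
  move=> aD bD; apply: pow2_mulr; rewrite -{1}(@subnK 2 n) ?(ltnW n_ge3) //.
  by apply: pow2M; apply: pow2X1.
have P1 a b (p q c : R) : pow2 a b n p -> pow2 a b n (q * p ^+ 2 * c).
  by move=> pP; rewrite expr2; apply: pow2_mulr; apply: pow2_mull; exact: pow2_mull.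
have P2 a b (p q : R) : pow2 a b n p -> pow2 a b n (p ^+ (n - 2) * q).
  move=> pP; rewrite -(subnSK n_ge3) exprS -mulrA; exact: pow2_mulr.
have P3 a b (q : R) : pow2 a b n (q * a ^+ n).
  by apply: pow2_mull; apply: pow2X1; exact: pow2_gen1.
have P4 a b (q : R) : pow2 a b n (q * b ^+ n).
  by apply: pow2_mull; apply: pow2X1; exact: pow2_gen2.
have fP := @fermat_axis y z; have gP := @fermat_axis z x; have hP := @fermat_axis x y.
rewrite /third_gen; split; do 2?apply: pow2D; auto.
all: by rewrite -mulrA; apply: P2.
Qed.

(* The factor [g * h] puts this element in the powers of the other two axes,
   whatever [a] is. *)
Lemma part_pow a : pow2 y z n a -> fermat_pow x y z n n (g ^+ n.-1 * h * a).
Proof.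
move=> ay; split; last 2 first.
- rewrite mulrAC -mulrA -(@prednK n.-1) 1?exprS; last by case: n n_ge3 => [|[]].
  by do 2!apply: pow2_mulr; exact: fermat_axis.
- by apply: pow2_mulr; apply: pow2_mull; exact: fermat_axis.
- apply: pow2_mulr; rewrite -[X in pow2 _ _ X](prednK n_gt0) -addn1.
  by apply: pow2M => //; exact: pow2X1.
- exact: pow2_mull.
Qed.

Lemma prime_to_gf : prime_to g f.
Proof. exact: prime_to_sym (fermat_neq0 co) (prime_to_fermat co). Qed.

Lemma divides_fgh r : divides f r -> divides g r -> divides h r -> divides (f * g * h) r.
Proof.
move=> fr gr hr; apply: divides_mul_prime_to => //; last exact: divides_mul_prime_to prime_to_gf _ _.
apply: prime_toM; first exact: prime_to_fermat co''.
exact: prime_to_fermat' co''.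
Qed.

Lemma part_mod_fgh r : fermat_pow x y z n n r ->
  exists a, pow2 y z n a /\ divides f (r + g ^+ n.-1 * h * a).
Proof.
case=> rD ry _ _; have [a [ay [t e]]] := fermat_mod co rD ry.
exists a; split=> //; exists (t - g ^+ n.-1 * a).
rewrite [RHS]mulrBr -e h_def gX; move: (g ^+ n.-1) => u; ring.
Qed.

Lemma part_mod_third r : fermat_pow x y z (n + n) (n + n) r ->
  exists a, pow2 y z n a /\ divides f (r + (-1) ^+ n * (third_gen x y z * (g ^+ n.-1 * h * a))).
Proof.
case=> rD ry _ _; have [a [ay [t e]]] := fermat_mod2 co rD ry.
exists a; split=> //; have [u eu] := third_gen_mod.
exists (t + (-1) ^+ n * u * (g ^+ n.-1 * h * a) - g ^+ n * z ^+ n * g ^+ n.-1 * a).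
have eq_t : third_gen x y z = f * u + (-1) ^+ n * g ^+ n * z ^+ n by rewrite -eu; ring.
have e_r : r = f * t + g ^+ (n + n) * (z ^+ n * a) by rewrite -e; ring.
have sgn : (-1) ^+ n * (-1) ^+ n = 1 :> R by rewrite -exprMn mulrNN mul1r expr1n.
rewrite eq_t e_r h_def exprD gX.
move: (g ^+ n.-1) (z ^+ n) ((-1) ^+ n) sgn => G Z s ss.
transitivity (f * t + g * G * g * G * Z * a + s * f * u * (G * (- g - f) * a)
  + (s * s) * g * G * Z * G * (- g - f) * a); first by ring.
rewrite ss; ring.
Qed.

End Parts.

(** * Decomposition of elements of A and of products of two of them *)

Section Decomposition.
Variables x y z : R.
Hypothesis co : coordinates x y z.
Let co' := coordinates_cyc co.
Let co'' := coordinates_cyc co'.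
Local Notation f := (fermat y z).
Local Notation g := (fermat z x).
Local Notation h := (fermat x y).
Local Notation q := (third_gen x y z).

Lemma fermat_pow_cyc2 m k r : fermat_pow z x y m k r -> fermat_pow x y z m k r.
Proof. exact: fermat_pow_cyc. Qed.

Lemma fermat_pow_cyc1 m k r : fermat_pow y z x m k r -> fermat_pow x y z m k r.
Proof. by move/fermat_pow_cyc/fermat_pow_cyc. Qed.

Let axisX' (u v w s : R) (cu : coordinates u v w) k c :
  ~ pow2 v w 1 s -> pow2 v w n (s ^+ k * c) -> pow2 v w n c.
Proof. move=> sP; apply: axis_primary => //; exact: axisX. Qed.

(** Each of f, g, h costs one in D. On a given axis one of them accounts for the exponent n, and the
    other two do not vanish there, so they cancel freely. *)
Lemma fermat_pow_cancel m r :
  fermat_pow x y z m.+3 (n + n) (f * g * h * r) -> fermat_pow x y z m n r.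
Proof.
case=> rD r1 r2 r3; split.
- have : pow2 f g m.+2 (g * (h * r)).
    by apply: (pow2_fermat_cancel co); rewrite !mulrA.
  move/pow2_fermat_cyc/(pow2_fermat_cancel co')/pow2_fermat_cyc.
  by move/(pow2_fermat_cancel co'')/pow2_fermat_cyc.
- apply: (axis_primary co (axisNh co)); apply: (axis_primary co (axisNg co)).
  by apply: (axis_cancel co); rewrite !mulrA.
- apply: (axis_primary co' (axisNh co')); apply: (axis_primary co' (axisNg co')).
  by apply: (axis_cancel co'); move: r2; rewrite (_ : f * g * h * r = g * (h * (f * r))) //; ring.
- apply: (axis_primary co'' (axisNh co'')); apply: (axis_primary co'' (axisNg co'')).
  by apply: (axis_cancel co''); move: r3; rewrite (_ : f * g * h * r = h * (f * (g * r))) //; ring.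
Qed.

(** It suffices that f and h divide a and that g divides b: this gives three of the six axis
    conditions. The other three follow from r, because g is nonzero on the axes (y, z) and (x, y),
    and f on (z, x), so that the remaining part can be solved for. *)
Lemma split_by_powers r : fermat_pow x y z (n - 3 + n) n r ->
  exists a b, [/\ fermat_pow x y z n n a, fermat_pow x y z n n b
                & r = f ^+ (n - 3) * a + g ^+ (n - 3) * b].
Proof.
have [k nE] : exists k, n = k.+3 by exists (n - 3)%N; move: n_ge3; clear; lia.
have -> : (n - 3 = k)%N by lia.
case=> rD r1 r2 r3.
have [a0 [s [a0D sD r_def]]] := pow2_split rD.
(* The split leaves g^(n+1) s, and n + 1 = (n - 3) + 4. *)
pose b0 := g ^+ 4 * s.
have gD j : pow2 f g j (g ^+ j) by apply: pow2X1; exact: pow2_gen2.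
have fD j : pow2 f g j (f ^+ j) by apply: pow2X1; exact: pow2_gen1.
have hD : pow2 f g 1 h.
  rewrite (_ : h = - f - g); last by rewrite /fermat; ring.
  by apply: pow2B; [apply: pow2N; exact: pow2_gen1 | exact: pow2_gen2].
have b0D : pow2 f g n b0.
  apply: (@pow2W _ _ _ (4 + k.-1)); first by rewrite nE; case: (k).
  exact: pow2M.
have rE : r = f ^+ k * a0 + g ^+ k * b0.
  rewrite r_def /b0; congr (_ + _); rewrite mulrA -exprD; congr (_ ^+ _ * _).
  by rewrite nE; lia.
(* Residues: a0 is g^n a1 modulo f, b0 is f^n b1 modulo g, a0 is g^n a2 modulo h. In [c] below each
   of them is multiplied by a form that vanishes modulo the other two of f, g, h, as in the Chinese
   remainder theorem; h = -g modulo f and its analogues fix the signs. *)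
have [a1 [u1 e1]] := pow2_mod_fst a0D.
have [b1 [u2 e2]] := pow2_mod_fst (pow2C b0D).
have [a2 [u3 e3]] := pow2_mod_fst (pow2C (pow2_fermat_cyc a0D)).
(* [a0], [b0] may be replaced with [a0 + g^k c], [b0 - f^k c]; this [c] makes
   [f] and [h] divide the former and [g] the latter. *)
pose c := g ^+ 2 * h * a1 - f ^+ 2 * h * b1 + f * g ^+ 2 * a2.
pose a := a0 + g ^+ k * c; pose b := b0 - f ^+ k * c.
have cD : pow2 f g 3 c.
  rewrite /c; apply: pow2D; last by apply: pow2_mulr; exact: (@pow2M _ _ _ 1 2).
  by apply: pow2B; apply: pow2_mulr; exact: (@pow2M _ _ _ 2 1).
have nE3 : n = (k + 3)%N by rewrite nE addn3.
have aD : pow2 f g n a by apply: pow2D => //; rewrite {1}nE3; exact: pow2M.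
have bD : pow2 f g n b by apply: pow2B => //; rewrite {1}nE3; exact: pow2M.
have rE' : r = f ^+ k * a + g ^+ k * b by rewrite rE /a /b; ring.
have hE : h = - f - g by rewrite /fermat; ring.
have gn : g ^+ n = g ^+ k * g ^+ 3 by rewrite nE3 exprD.
have fn : f ^+ n = f ^+ k * f ^+ 3 by rewrite nE3 exprD.
have fa : divides f a.
  exists (u1 + g ^+ k * (g ^+ 2 * a2 - g ^+ 2 * a1 - f * h * b1)).
  rewrite [RHS]mulrDr -e1 gn /a /c hE; move: (g ^+ k) => G; ring.
have gb : divides g b.
  exists (u2 - f ^+ k * (g * h * a1 + f ^+ 2 * b1 + f * g * a2)).
  rewrite [RHS]mulrBr -e2 fn /b /c hE; move: (f ^+ k) => F; ring.
have ha : divides h a.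
  exists (u3 + g ^+ k * (g ^+ 2 * a1 - f ^+ 2 * b1 - g ^+ 2 * a2)).
  rewrite /a (_ : a0 = h * u3 + g ^+ n * a2); last by rewrite -e3; ring.
  by rewrite gn /c hE; move: (g ^+ k) => G; ring.
have dP (u v w : R) (cu : coordinates u v w) d : divides (fermat v w) d -> pow2 v w n d.
  by case=> t ->; apply: pow2_mulr; exact: fermat_axis.
have a_1 : pow2 y z n a := dP _ _ _ co _ fa.
have b_2 : pow2 z x n b := dP _ _ _ co' _ gb.
have a_3 : pow2 x y n a := dP _ _ _ co'' _ ha.
have eb : g ^+ k * b = r - f ^+ k * a by rewrite rE'; ring.
have ea : f ^+ k * a = r - g ^+ k * b by rewrite rE'; ring.
have b_1 : pow2 y z n b.
  have : pow2 y z n (g ^+ k * b) by rewrite eb; apply: pow2B => //; exact: pow2_mull.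
  exact: (axisX' co (axisNg co)).
have b_3 : pow2 x y n b.
  have : pow2 x y n (g ^+ k * b) by rewrite eb; apply: pow2B => //; exact: pow2_mull.
  exact: (axisX' co'' (axisNh co'')).
have a_2 : pow2 z x n a.
  have : pow2 z x n (f ^+ k * a) by rewrite ea; apply: pow2B => //; exact: pow2_mull.
  exact: (axisX' co' (axisNh co')).
by exists a, b; split=> //; split.
Qed.

(** The corrections for f, g, h do not interfere: each of [l1], [l2], [l3] is divisible by the two
    forms it is not meant for. After all three, f g h divides the rest. *)
Lemma fermat_pow_double r : fermat_pow x y z (n + n) (n + n) r ->
  exists a b c, [/\ fermat_pow x y z n n a, fermat_pow x y z n n b, fermat_pow x y z n n c
    & r = f ^+ (n - 2) * g * h * a + f * g ^+ (n - 2) * h * b + q * c].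
Proof.
move=> rQ.
have [a1 [a1P d1]] := part_mod_third co rQ.
have [a2 [a2P d2]] := part_mod_third co' (fermat_pow_cyc rQ).
have [a3 [a3P d3]] := part_mod_third co'' (fermat_pow_cyc (fermat_pow_cyc rQ)).
rewrite third_gen_cyc in d2; rewrite 2!third_gen_cyc in d3.
have [m nE] : exists m, n = m.+2 by exists (n - 2)%N; move: n_ge3; clear; lia.
have L1 := @part_pow x y z _ a1P; have /fermat_pow_cyc1 L2 := @part_pow y z x _ a2P.
have /fermat_pow_cyc2 L3 := @part_pow z x y _ a3P.
set l1 := _ * a1 in d1 L1; set l2 := _ * a2 in d2 L2; set l3 := _ * a3 in d3 L3.
have exprP (s : R) : s ^+ n.-1 = s * s ^+ m by rewrite nE /= exprS.
have f2 : divides f l2 by exists (h ^+ n.-1 * a2); rewrite /l2; ring.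
have f3 : divides f l3 by exists (f ^+ m * g * a3); rewrite /l3 exprP; ring.
have g1 : divides g l1 by exists (g ^+ m * h * a1); rewrite /l1 exprP; ring.
have g3 : divides g l3 by exists (f ^+ n.-1 * a3); rewrite /l3; ring.
have h1 : divides h l1 by exists (g ^+ n.-1 * a1); rewrite /l1; ring.
have h2 : divides h l2 by exists (h ^+ m * f * a2); rewrite /l2 exprP; ring.
pose s : R := (-1) ^+ n.
have [e def_e] : divides (f * g * h) (r + s * (q * (l1 + l2 + l3))).
  apply: (divides_fgh co).
  - rewrite (_ : r + _ = (r + s * (q * l1)) + (s * q * l2 + s * q * l3)); last by ring.
    by apply: dividesD => //; apply: dividesD; exact: divides_mull.
  - rewrite (_ : r + _ = (r + s * (q * l2)) + (s * q * l1 + s * q * l3)); last by ring.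
    by apply: dividesD => //; apply: dividesD; exact: divides_mull.
  - rewrite (_ : r + _ = (r + s * (q * l3)) + (s * q * l1 + s * q * l2)); last by ring.
    by apply: dividesD => //; apply: dividesD; exact: divides_mull.
have lQ : fermat_pow x y z n n (l1 + l2 + l3) by do 2?apply: fermat_powD.
have eQ : fermat_pow x y z (n - 3 + n) n e.
  apply: fermat_pow_cancel; rewrite -def_e -(_ : n + n = (n - 3 + n).+3)%N; last by move: n_ge3; clear; lia.
  apply: fermat_powD => //; apply: fermat_pow_mull; apply: fermat_powM => //.
  exact: third_gen_pow.
have [a [b [aQ bQ def_e']]] := split_by_powers eQ.
exists a, b, (- s * (l1 + l2 + l3)); split=> //; first exact: fermat_pow_mull.
rewrite -[LHS](addrK (s * (q * (l1 + l2 + l3)))) def_e def_e'.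
rewrite -(subnSK n_ge3) !exprS.
by ring.
Qed.

(** The same scheme with exponent n and without q. It writes A as an explicit sum of finitely
    generated ideals, as the determinant trick requires. *)
Lemma fermat_pow_gens r : fermat_pow x y z n n r ->
  exists e a b c, [/\ pow2 y z n a, pow2 z x n b, pow2 x y n c, pow2 f g (n - 3) e &
    r = f * g * h * e + g ^+ n.-1 * h * a + h ^+ n.-1 * f * b + f ^+ n.-1 * g * c].
Proof.
move=> rQ.
have [a1 [a1P d1]] := part_mod_fgh co rQ.
have [a2 [a2P d2]] := part_mod_fgh co' (fermat_pow_cyc rQ).
have [a3 [a3P d3]] := part_mod_fgh co'' (fermat_pow_cyc (fermat_pow_cyc rQ)).
have [m nE] : exists m, n = m.+2 by exists (n - 2)%N; move: n_ge3; clear; lia.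
have L1 := @part_pow x y z _ a1P; have /fermat_pow_cyc1 L2 := @part_pow y z x _ a2P.
have /fermat_pow_cyc2 L3 := @part_pow z x y _ a3P.
set l1 := _ * a1 in d1 L1; set l2 := _ * a2 in d2 L2; set l3 := _ * a3 in d3 L3.
have exprP (s : R) : s ^+ n.-1 = s * s ^+ m by rewrite nE /= exprS.
have f2 : divides f l2 by exists (h ^+ n.-1 * a2); rewrite /l2; ring.
have f3 : divides f l3 by exists (f ^+ m * g * a3); rewrite /l3 exprP; ring.
have g1 : divides g l1 by exists (g ^+ m * h * a1); rewrite /l1 exprP; ring.
have g3 : divides g l3 by exists (f ^+ n.-1 * a3); rewrite /l3; ring.
have h1 : divides h l1 by exists (g ^+ n.-1 * a1); rewrite /l1; ring.
have h2 : divides h l2 by exists (h ^+ m * f * a2); rewrite /l2 exprP; ring.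
have [e def_e] : divides (f * g * h) (r + l1 + l2 + l3).
  apply: (divides_fgh co).
  - by do 2?apply: dividesD.
  - by rewrite -addrA addrAC addrA addrAC -addrA; do 2?apply: dividesD => //; rewrite addrC.
  - by rewrite addrAC (addrAC r) addrAC; do 2?apply: dividesD.
exists e, (- a1), (- a2), (- a3); split; try exact: pow2N.
  have : fermat_pow x y z n n (f * g * h * e) by rewrite -def_e; do 3?apply: fermat_powD.
  case=> eD _ _ _; move: eD; rewrite {1}(_ : n = (n - 3).+3); last by move: n_ge3; clear; lia.
  rewrite -!mulrA => /(pow2_fermat_cancel co)/pow2_fermat_cyc/(pow2_fermat_cancel co').
  by move/pow2_fermat_cyc/(pow2_fermat_cancel co'')/pow2_fermat_cyc.
rewrite -def_e /l1 /l2 /l3; ring.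
Qed.

End Decomposition.

Hypothesis uniqW : uniq W.

(** * The n^2 common zeros of f and g *)

Section Points.
Variables x y z : R.
Hypothesis co : coordinates x y z.
Let co' := coordinates_cyc co.
Let co'' := coordinates_cyc co'.
Local Notation f := (fermat y z).
Local Notation g := (fermat z x).
Local Notation h := (fermat x y).
Let n_gt0 : (0 < n)%N. Proof. exact: leq_trans n_ge3. Qed.

(* The ideal of the point (1 : w : v), one of the n^2 common zeros of f, g. *)
Definition point (w v : K) r :=
  exists a b, r = a * (y - iota w * x) + b * (z - iota v * x).

Lemma root_pow w : w \in W -> iota w ^+ n = 1.
Proof.
move=> wW; apply/eqP; rewrite -subr_eq0 -(expr1n _ n) fermat_factor.
by rewrite (big_rem w) //= mulr1 subrr mul0r.
Qed.

Lemma point_subst w v : exists rho : {rmorphism R -> R},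
  [/\ rho x = x, rho y = iota w * x, rho z = iota v * x,
      (forall k, rho (iota k) = iota k) & forall r, point w v r <-> rho r = 0].
Proof.
have [rho [rx ry rz ri rr]] := co x (iota w * x) (iota v * x).
exists rho; split=> // r; split=> [[a [b ->]]|r0].
  by rewrite rmorphD !rmorphM !rmorphB ry rz !rmorphM !ri rx !subrr !mulr0 addr0.
have [a [b [c]]] := rr r; rewrite r0 subr0 => ->.
by exists b, c; rewrite subrr mulr0 add0r.
Qed.

Lemma point_prime w v : is_prime_ideal (point w v).
Proof.
have [rho [_ _ _ _ rP]] := point_subst w v; split; first split.
- by apply/rP; rewrite rmorph0.
- by move=> a b /rP a0 /rP b0; apply/rP; rewrite rmorphD a0 b0 addr0.
- by move=> c a /rP a0; apply/rP; rewrite rmorphM a0 mulr0.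
- by move/rP/eqP; rewrite rmorph1 oner_eq0.
- move=> a b /rP /eqP; rewrite rmorphM mulf_eq0.
  by case/orP=> /eqP ?; [left | right]; apply/rP.
Qed.

Lemma fermat_sub_point w v r : w \in W -> v \in W -> pow2 f g 1 r -> point w v r.
Proof.
have [rho [rx ry rz _ rP]] := point_subst w v => /root_pow w1 /root_pow v1.
move=> [c [d [_ ->]]]; apply/rP.
rewrite expr1 rmorphD !rmorphM !rmorphB !rmorphXn rx ry rz !exprMn w1 v1.
by rewrite !mul1r subrr !mul0r addr0.
Qed.

Lemma iota_scale_neq0 w v : w != v -> iota w * x - iota v * x != 0.
Proof.
move=> wv; rewrite -mulrBl -rmorphB mulf_neq0 ?(coord_neq0 co) //.
by rewrite fmorph_eq0 subr_eq0.
Qed.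

(** Newton interpolation on the line y = w x of the projective plane: a factor z - v x is split off
    for each root v, and it does not vanish at the points of the other roots. *)
Lemma point_interp_z w (s : seq K) c : uniq s -> (forall v, v \in s -> point w v c) ->
  exists a b, c = a * (y - iota w * x) + b * \prod_(v <- s) (z - iota v * x).
Proof.
elim: s c => [|v s IHs] c; first by exists 0, c; rewrite big_nil mul0r mulr1 add0r.
move=> /= /andP[vs us] cs.
have [a [b ec]] := cs v (mem_head _ _).
have [u us'|a' [b' eb]] := IHs b us.
  have [rho [rx ry rz ri rP]] := point_subst w u.
  have /rP := cs u (@mem_behead _ (v :: s) u us').
  rewrite ec rmorphD !rmorphM !rmorphB ry rz !rmorphM !ri rx subrr mulr0 add0r.
  move/eqP; rewrite mulf_eq0 (negPf (iota_scale_neq0 _)) ?orbF => [/eqP/rP //|].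
  by apply: contraNneq vs => <-.
exists (a + a' * (z - iota v * x)), b'.
by rewrite big_cons ec eb; ring.
Qed.

(** Interpolation across the lines y = w x: using all n roots v on one line leaves a multiple of y -
    w x plus a multiple of g, and g vanishes at the points of the other lines too. *)
Lemma point_interp_y (s : seq K) c : uniq s ->
  (forall w v, w \in s -> v \in W -> point w v c) ->
  exists a b, c = a * \prod_(w <- s) (y - iota w * x) + b * g.
Proof.
elim: s c => [|w s IHs] c; first by exists c, 0; rewrite big_nil mul0r mulr1 addr0.
move=> /= /andP[ws us] cs.
have [|a [b ec]] := @point_interp_z w W c uniqW.
  by move=> v vW; apply: cs => //; exact: mem_head.
rewrite -fermat_factor -/(fermat z x) in ec.
have [u v us' vW|a' [b' ea]] := IHs a us.
  have [rho [rx ry rz ri rP]] := point_subst u v.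
  have /rP := cs u v (@mem_behead _ (w :: s) u us') vW.
  have g0 : rho g = 0 by rewrite rmorphB !rmorphXn rx rz exprMn root_pow // mul1r subrr.
  rewrite ec rmorphD !rmorphM g0 mulr0 addr0 rmorphB ry rmorphM ri rx.
  move/eqP; rewrite mulf_eq0 (negPf (iota_scale_neq0 _)) ?orbF => [/eqP/rP //|].
  by apply: contraNneq ws => <-.
exists a', (b + b' * (y - iota w * x)).
by rewrite big_cons ec ea; ring.
Qed.

Lemma fermat_points c : (forall w v, w \in W -> v \in W -> point w v c) -> pow2 f g 1 c.
Proof.
move=> cP; have [|a [b ->]] := @point_interp_y W c uniqW.
  by move=> w v; exact: cP.
rewrite -fermat_factor; apply: pow2D; last by apply: pow2_mull; exact: pow2_gen2.
apply: pow2_mull; rewrite (_ : _ - _ = f + g); last by rewrite /fermat; ring.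
by apply: pow2D; [exact: pow2_gen1 | exact: pow2_gen2].
Qed.

Lemma fermat_primary m r :
  (forall w v, w \in W -> v \in W -> exists s, ~ point w v s /\ pow2 f g m (s * r)) ->
  pow2 f g m r.
Proof.
move=> rP; pose P (i : {p | (p.1 \in W) && (p.2 \in W)}) := point (val i).1 (val i).2.
apply: (@pow2_primary _ _ P).
- exact: fermat_neq0 co.
- exact: prime_to_fermat co.
- by case=> p pW c; case/andP: (pW) => w v; exact: fermat_sub_point.
- move=> c cP; apply: fermat_points => w v wW vW.
  by apply: (cP (exist _ (w, v) _)) => /=; rewrite wW.
- by move=> i c d; case: (point_prime (val i).1 (val i).2) => _ _; apply.
- by case=> p pW; case/andP: (pW) => w v; exact: rP.
Qed.

Local Notation I := (ideal_gen [:: x * f; y * g; z * h]).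
Let idI : is_ideal I. Proof. exact: ideal_gen_ideal. Qed.
Let xfI c : I (c * (x * f)).
Proof. by apply/ideal_gen3; exists c, 0, 0; ring. Qed.
Let ygI c : I (c * (y * g)).
Proof. by apply/ideal_gen3; exists 0, c, 0; ring. Qed.
Let zhI c : I (c * (z * h)).
Proof. by apply/ideal_gen3; exists 0, 0, c; ring. Qed.

Lemma associated_point w v : w \in W -> v \in W -> associated_prime I (point w v).
Proof.
move=> wW vW; split; first exact: point_prime.
pose B := \prod_(u <- rem w W) (y - iota u * x).
pose C := \prod_(u <- rem v W) (z - iota u * x).
have hB : (y - iota w * x) * B = - h.
  by rewrite opprB fermat_factor (big_rem w).
have gC : (z - iota v * x) * C = g.
  by rewrite /fermat fermat_factor (big_rem v).
have [rho [rx ry rz ri rP]] := point_subst w v.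
have nz_rem u (t : R) : u \in W -> rho t = iota u * x ->
    rho (\prod_(k <- rem u W) (t - iota k * x)) != 0.
  move=> uW rt; rewrite rmorph_prod prodf_seq_neq0; apply/allP => k.
  rewrite mem_rem_uniq // inE => /andP[ku _] /=.
  by rewrite rmorphB rt rmorphM ri rx iota_scale_neq0 // eq_sym.
have x0 := coord_neq0 co.
have iota0 u : u \in W -> iota u != 0.
  move/root_pow => u1; apply/eqP => u0; move: u1.
  by rewrite u0 expr0n gtn_eqF // => /eqP; rewrite eq_sym oner_eq0.
(* B and C are -h and g without the factor that vanishes at the point. Multiplying by that factor
   restores h or g, and the variables make it a multiple of z h or y g. At the point itself the
   witness is nonzero, the roots being distinct and nonzero. *)
exists (x * y * z * B * C) => r; split=> [[a [b ->]]|].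
  rewrite (_ : (_ + _) * _ = (- a * x * y * C) * (z * h) + (b * x * z * B) * (y * g)).
    by case: idI => _ ID _; apply: ID.
  by rewrite -gC -[h]opprK -hB; ring.
case/ideal_gen3=> a [b [c e]].
suff : point w v (r * (x * y * z * B * C)).
  move/rP/eqP; rewrite rmorphM mulf_eq0 => /orP[/eqP/rP //|].
  rewrite !rmorphM rx ry rz !mulf_eq0 (negPf x0) (negPf (iota0 _ wW)) (negPf (iota0 _ vW)) /=.
  by rewrite (negPf (nz_rem _ _ wW ry)) (negPf (nz_rem _ _ vW rz)).
rewrite e; apply: fermat_sub_point => //.
apply: pow2D; first apply: pow2D.
- by do 2!apply: pow2_mull; exact: pow2_gen1.
- by do 2!apply: pow2_mull; exact: pow2_gen2.
- do 2!apply: pow2_mull; rewrite (_ : h = - f - g); last by rewrite /fermat; ring.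
  by apply: pow2B; [apply: pow2N; exact: pow2_gen1 | exact: pow2_gen2].
Qed.

End Points.

(** * Associated primes of I and its n-th symbolic power *)

Section SymbolicPower.
Variables x y z : R.
Hypothesis co : coordinates x y z.
Let co' := coordinates_cyc co.
Let co'' := coordinates_cyc co'.
Local Notation f := (fermat y z).
Local Notation g := (fermat z x).
Local Notation h := (fermat x y).
Let n_gt0 : (0 < n)%N. Proof. exact: leq_trans n_ge3. Qed.
Local Notation I := (ideal_gen [:: x * f; y * g; z * h]).
Let idI : is_ideal I. Proof. exact: ideal_gen_ideal. Qed.

Lemma fermat_ideal_cyc r : I r -> ideal_gen [:: y * g; z * h; x * f] r.
Proof.
by case/ideal_gen3=> a [b [c ->]]; apply/ideal_gen3; exists b, c, a; ring.
Qed.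

Lemma fermat_ideal_D : sub_ideal I (pow2 f g 1).
Proof.
move=> _ /ideal_gen3 [a [b [c ->]]]; apply: pow2D; first apply: pow2D.
- by do 2!apply: pow2_mull; exact: pow2_gen1.
- by do 2!apply: pow2_mull; exact: pow2_gen2.
- do 2!apply: pow2_mull; rewrite (_ : h = - f - g); last by rewrite /fermat; ring.
  by apply: pow2B; [apply: pow2N; exact: pow2_gen1 | exact: pow2_gen2].
Qed.

Lemma fermat_ideal_axis : sub_ideal I (pow2 y z 1).
Proof.
move=> _ /ideal_gen3 [a [b [c ->]]]; apply: pow2D; first apply: pow2D.
- do 2!apply: pow2_mull; exact: (pow2W n_gt0 (@fermat_axis _ _)).
- by apply: pow2_mull; apply: pow2_mulr; exact: pow2_gen1.
- by apply: pow2_mull; apply: pow2_mulr; exact: pow2_gen2.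
Qed.

Lemma axis_prime_ideal : is_prime_ideal (pow2 y z 1).
Proof.
split; [exact: pow2_ideal | | by move=> a b; exact: axis_prime].
by have [rho [_ _ _ rP]] := axis_ideal co; move/rP/eqP; rewrite rmorph1 oner_eq0.
Qed.

Lemma associated_axis : associated_prime I (pow2 y z 1).
Proof.
split; first exact: axis_prime_ideal.
(* y g and z h lie in I, while neither g nor h vanishes on the axis. *)
exists (g * h) => r; split=> [[d [s [_ ->]]]|].
  by apply/ideal_gen3; exists 0, (d * h), (s * g); rewrite expr1; ring.
move/fermat_ideal_axis/(axis_prime co) => [//|/(axis_prime co)[]].
  by move/(axisNg co).
by move/(axisNh co).
Qed.

(** Read r = f a + g b on each axis, where one of f, g, h vanishes: b lies in (y, z), a in (z, x), b
    - a in (x, y). Solving these conditions and using f + g + h = 0 gives coefficients on x f, y g,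
    z h. *)
Lemma fermat_inter r :
  pow2 f g 1 r -> pow2 y z 1 r -> pow2 z x 1 r -> pow2 x y 1 r -> I r.
Proof.
move=> [a [b [_ ->]]]; rewrite expr1 => r1 r2 r3.
have fP : pow2 y z 1 f := pow2W n_gt0 (@fermat_axis y z).
have gP : pow2 z x 1 g := pow2W n_gt0 (@fermat_axis z x).
have hP : pow2 x y 1 h := pow2W n_gt0 (@fermat_axis x y).
have bP : pow2 y z 1 b.
  have : pow2 y z 1 (g * b).
    by rewrite (_ : g * b = f * a + g * b - f * a); [apply: pow2B => //; exact: pow2_mulr | ring].
  by case/(axis_prime co) => // /(axisNg co).
have aP : pow2 z x 1 a.
  have : pow2 z x 1 (f * a).
    by rewrite (_ : f * a = f * a + g * b - g * b); [apply: pow2B => //; exact: pow2_mulr | ring].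
  by case/(axis_prime co') => // /(axisNh co').
have abP : pow2 x y 1 (b - a).
  have : pow2 x y 1 (g * (b - a)).
    rewrite (_ : g * (b - a) = f * a + g * b + h * a); last by rewrite /fermat; ring.
    by apply: pow2D => //; exact: pow2_mulr.
  by case/(axis_prime co'') => // /(axisNh co'').
move: aP bP abP => [d [s [_ ->]]] [d' [s' [_ ->]]]; rewrite !expr1 => abP.
have : pow2 x y 1 (z * (s' - d)).
  rewrite (_ : z * _ = y * d' + z * s' - (z * d + x * s) - y * d' + x * s); last by ring.
  apply: pow2D; last by apply: pow2_mulr; exact: pow2_gen1.
  by apply: pow2B => //; apply: pow2_mulr; exact: pow2_gen2.
case/(axis_prime co'') => [/(axisNx co'')//|[e [k [_ e_s]]]].
have {e_s} -> : s' = d + x * e + y * k by rewrite -[LHS](subrK d) e_s expr1; ring.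
apply/ideal_gen3; exists (s - z * e), (d' + z * k), (- d - x * e).
rewrite /fermat; ring.
Qed.

Lemma symbolic_power_axis r : symbolic_power I n r -> pow2 y z n r.
Proof.
move/(_ _ associated_axis); rewrite (contracted_idealP _ axis_prime_ideal (ideal_exp_ideal _ _)).
case=> s [sP /(ideal_exp_pow2 fermat_ideal_axis)]; exact: axis_primary.
Qed.

End SymbolicPower.

Section SymbolicPowerE.
Variables x y z : R.
Hypothesis co : coordinates x y z.
Let co' := coordinates_cyc co.
Let co'' := coordinates_cyc co'.
Local Notation f := (fermat y z).
Local Notation g := (fermat z x).
Local Notation h := (fermat x y).
Local Notation I := (ideal_gen [:: x * f; y * g; z * h]).
Let idI : is_ideal I. Proof. exact: ideal_gen_ideal. Qed.

(** I is an intersection of primes each of which misses a variable. This rules out an associated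
    prime containing x, y and z. *)
Lemma fermat_ideal_saturated a : I (x * a) -> I (y * a) -> I (z * a) -> I a.
Proof.
move=> xa ya za; apply: (fermat_inter co).
- apply: (fermat_primary co) => // w v _ _; exists x; split; last exact: fermat_ideal_D.
  have [rho [rx _ _ _ rP]] := point_subst co w v; move/rP/eqP.
  by rewrite rx (negPf (coord_neq0 co)).
- by case/(@fermat_ideal_axis x y z)/(axis_prime co): xa => // /(axisNx co).
- move/fermat_ideal_cyc: ya => /(@fermat_ideal_axis y z x)/(axis_prime co').
  by case=> // /(axisNx co').
- move/fermat_ideal_cyc/(@fermat_ideal_cyc y z x): za.
  by move/(@fermat_ideal_axis z x y)/(axis_prime co'') => [/(axisNx co'')|].
Qed.

Lemma fermat_symbolic_power r : symbolic_power I n r <-> fermat_pow x y z n n r.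
Proof.
split=> [rA|[rD r1 r2 r3] p [pp [a aP]]].
  have e1 : I = ideal_gen [:: y * g; z * h; x * f].
    apply: ideal_ext => s; split; first exact: fermat_ideal_cyc.
    by move/(@fermat_ideal_cyc y z x)/(@fermat_ideal_cyc z x y).
  have e2 : I = ideal_gen [:: z * h; x * f; y * g].
    apply: ideal_ext => s; split; first by move/fermat_ideal_cyc/(@fermat_ideal_cyc y z x).
    by move/(@fermat_ideal_cyc z x y).
  split.
  - apply: (fermat_primary co) => w v wW vW.
    have := rA _ (associated_point co wW vW).
    rewrite (contracted_idealP _ (point_prime co w v) (ideal_exp_ideal _ _)).
    case=> s [sP Is]; exists s; split=> //.
    exact: (ideal_exp_pow2 (@fermat_ideal_D x y z)) Is.
  - exact: (symbolic_power_axis co).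
  - by apply: (symbolic_power_axis co'); rewrite -e1.
  - by apply: (symbolic_power_axis co''); rewrite -e2.
have [[p0 pD pM] p1 pP] := pp.
have pX s k : p (s ^+ k) -> p s by elim: k => [/p1 //|k IHk]; rewrite exprS => /pP [].
have local s b c : ~ p s -> I (s * b) -> I (s * c) -> pow2 b c n r ->
    contracted_ideal p (ideal_exp I n) r.
  move=> ps sb sc rbc; apply/(contracted_idealP _ pp (ideal_exp_ideal _ _)).
  exists (s ^+ n); split; first by move=> /pX.
  exact: (pow2_ideal_exp idI sb sc).
have NpM s t : ~ p s -> ~ p t -> ~ p (s * t) by move=> ps pt /pP [].
have Np s t : p s -> ~ p t -> ~ p (fermat s t) /\ ~ p (fermat t s).
  have n_gt0 : (0 < n)%N by exact: leq_trans n_ge3.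
  have sn : p s -> p (s ^+ n) by move=> ps; rewrite -(prednK n_gt0) exprSr; exact: pM.
  move=> /sn {sn}ps pt; split=> pf; apply: pt; apply: (@pX _ n).
    rewrite (_ : t ^+ n = s ^+ n + (- 1) * fermat s t); last by rewrite /fermat; ring.
    by apply: pD => //; exact: pM.
  by rewrite (_ : t ^+ n = s ^+ n + fermat t s); [exact: pD | rewrite /fermat; ring].
have mem3 s u v w : s = u * (x * f) + v * (y * g) + w * (z * h) -> I s.
  by move=> ->; apply/ideal_gen3; exists u, v, w.
have rD' := pow2_fermat_cyc rD; have rD'' := pow2_fermat_cyc rD'.
(* Associated primes need not be classified; it matters only which variables p contains. All three
   is excluded by saturation; with exactly two, I becomes that axis ideal at p; with at most one, it
   becomes D. *)
case: (classic (p x)) => px; case: (classic (p y)) => py; case: (classic (p z)) => pz.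
- case: p1; apply/aP; rewrite mul1r.
  by apply: fermat_ideal_saturated; exact/aP.
- have [_ Nf] := Np _ _ py pz; have [Nf' _] := Np _ _ py pz.
  have [_ Ng] := Np _ _ px pz.
  apply: (@local (f * g) x y) => //; first exact: NpM.
    by apply: (mem3 _ g 0 0); ring.
  by apply: (mem3 _ 0 f 0); ring.
- have [Nh _] := Np _ _ px py; have [_ Nf] := Np _ _ pz py.
  apply: (@local (f * h) z x) => //; first exact: NpM.
    by apply: (mem3 _ 0 0 f); ring.
  by apply: (mem3 _ h 0 0); ring.
- apply: (@local (y * z) g h) => //; first exact: NpM.
    by apply: (mem3 _ 0 z 0); ring.
  by apply: (mem3 _ 0 0 y); ring.
- have [Ng _] := Np _ _ pz px; have [_ Nh] := Np _ _ py px.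
  apply: (@local (g * h) y z) => //; first exact: NpM.
    by apply: (mem3 _ 0 h 0); ring.
  by apply: (mem3 _ 0 0 g); ring.
- apply: (@local (z * x) h f) => //; first exact: NpM.
    by apply: (mem3 _ 0 0 x); ring.
  by apply: (mem3 _ z 0 0); ring.
- apply: (@local (x * y) f g) => //; first exact: NpM.
    by apply: (mem3 _ y 0 0); ring.
  by apply: (mem3 _ 0 x 0); ring.
- apply: (@local (x * y) f g) => //; first exact: NpM.
    by apply: (mem3 _ y 0 0); ring.
  by apply: (mem3 _ 0 x 0); ring.
Qed.

End SymbolicPowerE.

(** * J is a reduction of A, with reduction number 1 *)

Section Reduction.
Variables x y z : R.
Hypothesis co : coordinates x y z.
Let co' := coordinates_cyc co.
Let co'' := coordinates_cyc co'.
Local Notation f := (fermat y z).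
Local Notation g := (fermat z x).
Local Notation h := (fermat x y).
Local Notation q := (third_gen x y z).
Local Notation A := (fermat_pow x y z n n).
Local Notation j1 := (f ^+ (n - 2) * g * h).
Local Notation j2 := (f * g ^+ (n - 2) * h).
Local Notation J := (ideal_gen [:: j1; j2; q]).
Let n_gt0 : (0 < n)%N. Proof. exact: leq_trans n_ge3. Qed.

Lemma fermat_pow_ideal : is_ideal A.
Proof. split; [exact: fermat_pow0 | exact: fermat_powD | exact: fermat_pow_mull]. Qed.

Lemma fermat_pow_fgh e : pow2 f g (n - 3) e -> A (f * g * h * e).
Proof.
move=> eD; split.
- have hD : pow2 f g 1 h.
    rewrite (_ : h = - f - g); last by rewrite /fermat; ring.
    by apply: pow2B; [apply: pow2N; exact: pow2_gen1 | exact: pow2_gen2].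
  rewrite -{1}(subnKC n_ge3); apply: pow2M => //; apply: (@pow2M _ _ _ 2) => //.
  by apply: (@pow2M _ _ _ 1); [exact: pow2_gen1 | exact: pow2_gen2].
- by do 3!apply: pow2_mulr; exact: fermat_axis.
- by do 2!apply: pow2_mulr; apply: pow2_mull; exact: fermat_axis.
- by apply: pow2_mulr; apply: pow2_mull; exact: fermat_axis.
Qed.

Lemma fermat_pow_j1 : A j1.
Proof.
rewrite (_ : j1 = f * g * h * f ^+ (n - 3)).
  by apply: fermat_pow_fgh; apply: pow2X1; exact: pow2_gen1.
by rewrite -(subnSK n_ge3) exprS; ring.
Qed.

Lemma fermat_pow_j2 : A j2.
Proof.
rewrite (_ : j2 = f * g * h * g ^+ (n - 3)).
  by apply: fermat_pow_fgh; apply: pow2X1; exact: pow2_gen2.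
by rewrite -(subnSK n_ge3) exprS; ring.
Qed.

Lemma reduction_sub : sub_ideal J A.
Proof.
apply: ideal_gen_min => [|a]; first exact: fermat_pow_ideal.
rewrite !inE => /or3P[] /eqP->; [exact: fermat_pow_j1 | exact: fermat_pow_j2 |].
exact: third_gen_pow.
Qed.

Lemma reduction_in1 : reduction_in J A 1.
Proof.
have A1 : ideal_exp A 1 = A by apply: ideal_ext; exact: ideal_exp1 fermat_pow_ideal.
rewrite /reduction_in -[ideal_exp A 2]/(ideal_mul A (ideal_exp A 1)) A1 => r; split.
  move: r; apply: ideal_mul_min => [|a b aA bA]; first exact: ideal_mul_ideal.
  have [_ mD _] := ideal_mul_ideal J A.
  have [c [d [e [cA dA eA ->]]]] := fermat_pow_double co (fermat_powM aA bA).
  by apply: (mD); first apply: (mD); apply: ideal_mul_mem => //; apply: ideal_gen_mem;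
    rewrite !inE eqxx ?orbT.
by apply: ideal_mulS => //; exact: reduction_sub.
Qed.

Lemma prime_to_third_gen : prime_to f q.
Proof.
apply: (prime_to_congr (@third_gen_mod x y z)); apply: prime_toM; last first.
  by apply: prime_toX; exact: prime_to_fermat_last co.
apply: prime_toM; last by apply: prime_toX; exact: prime_to_fermat co.
by apply: prime_toX; apply: prime_toN; exact: prime_to1.
Qed.

(** The witness g^(n-1) h y^(n-1) z lies in A. Were it in J, only the multiple w q would count
    modulo f; cancelling g^n z makes f divide y^(n-1) + (-1)^n w z^(n-1), and x = z = 0 makes y^n
    divide y^(n-1). *)
Lemma reduction_proper : ~ sub_ideal A J.
Proof.
pose e := g ^+ n.-1 * h * (y ^+ n.-1 * z) => AJ.
have /AJ /ideal_gen3 [u [v [w ew]]] : A e.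
  apply: part_pow; rewrite -{1}(prednK n_gt0) -addn1.
  by apply: pow2M; [apply: pow2X1; exact: pow2_gen1 | exact: pow2_gen2].
have [t et] := @third_gen_mod x y z.
have gX : g ^+ n = g * g ^+ n.-1 by rewrite -exprS prednK.
have zX : z ^+ n = z * z ^+ n.-1 by rewrite -exprS prednK.
have n2 : f ^+ (n - 2) = f * f ^+ (n - 3) by rewrite -(subnSK n_ge3) exprS.
pose s := y ^+ n.-1 + w * (-1) ^+ n * z ^+ n.-1.
have : divides f (g ^+ n * (z * s)).
  exists (- (u * f ^+ (n - 3) * g * h + v * g ^+ (n - 2) * h + w * t + g ^+ n.-1 * (y ^+ n.-1 * z))).
  have -> : g ^+ n * (z * s) = g ^+ n * (z * y ^+ n.-1) + w * (q - f * t).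
    by rewrite -et /s zX; ring.
  have -> : w * (q - f * t) = e - u * j1 - v * j2 - w * (f * t) by rewrite ew; ring.
  by rewrite /e n2 gX (_ : h = - f - g); [ring | rewrite /fermat; ring].
move/(prime_toX (prime_to_fermat co))/(prime_to_fermat_last co) => [c].
have [rho [_ ry rz _ _]] := co 0 y 0.
have n1 : (0 < n.-1)%N by move: n_ge3; clear; lia.
move/(congr1 rho); rewrite rmorphM rmorphB rmorphD !rmorphXn rmorphM rmorphXn ry rz.
rewrite !expr0n !gtn_eqF // mulr0 addr0 subr0 -{2}(prednK n_gt0) exprSr -mulrA.
rewrite -{1}[y ^+ _]mulr1 => /(mulfI (expf_neq0 _ (y_neq0 co))).
have [sig [_ sy _ _ _]] := co 0 0 0.
by move/(congr1 sig)/eqP; rewrite rmorph1 rmorphM sy mul0r oner_eq0.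
Qed.

Lemma fermat_is_reduction : is_reduction J A.
Proof.
split; [exact: ideal_gen_ideal | exact: fermat_pow_ideal | exact: reduction_sub |].
by exists 1%N; exact: reduction_in1.
Qed.

Lemma fermat_reduction_number : is_reduction_number J A 1.
Proof.
split=> [|[|//] red]; first exact: reduction_in1.
case: reduction_proper => r Ar; apply: (@ideal_mul_subl _ J (ideal_exp A 0)).
  exact: ideal_gen_ideal.
apply/red; have A1 := ideal_exp1 fermat_pow_ideal; exact/A1.
Qed.

Lemma finitely_generated_fermat_pow : finitely_generated A.
Proof.
pose scaled (c : R) (N : R -> Prop) := ideal_mul (fun r => exists d, r = c * d) N.
pose sum (N M : R -> Prop) r := exists a b, [/\ N a, M b & r = a + b].
rewrite (_ : fermat_pow x y z n n =
  sum (sum (sum (scaled (f * g * h) (pow2 f g (n - 3)))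
                (scaled (g ^+ n.-1 * h) (pow2 y z n)))
           (scaled (h ^+ n.-1 * f) (pow2 z x n)))
      (scaled (f ^+ n.-1 * g) (pow2 x y n))); last first.
  have in_scaled c (N : R -> Prop) r : N r -> scaled c N (c * r).
    by move=> Nr; apply: ideal_mul_mem => //; exists 1; rewrite mulr1.
  have scaled_A c (N : R -> Prop) r : (forall d, N d -> A (c * d)) -> scaled c N r -> A r.
    move=> NA; move: r; apply: ideal_mul_min => [|_ b [d ->] Nb]; first exact: fermat_pow_ideal.
    by rewrite mulrAC mulrC; apply: fermat_pow_mull; exact: NA.
  apply: ideal_ext => r; split.
    case/(fermat_pow_gens co) => e [a [b [c [aP bP cP eP ->]]]].
    exists (f * g * h * e + g ^+ n.-1 * h * a + h ^+ n.-1 * f * b), (f ^+ n.-1 * g * c).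
    split=> //; last exact: in_scaled.
    exists (f * g * h * e + g ^+ n.-1 * h * a), (h ^+ n.-1 * f * b).
    split=> //; last exact: in_scaled.
    by exists (f * g * h * e), (g ^+ n.-1 * h * a); split=> //; exact: in_scaled.
  case=> _ [d [[_ [c [[a [b [aA bA ->]]] cA ->]]] dA ->]].
  apply: fermat_powD; first apply: fermat_powD; first apply: fermat_powD.
  - by move: aA; apply: scaled_A; exact: fermat_pow_fgh.
  - by move: bA; apply: scaled_A; exact: part_pow.
  - by move: cA; apply: scaled_A => t /(@part_pow y z x); exact: fermat_pow_cyc1.
  - by move: dA; apply: scaled_A => t /(@part_pow z x y); exact: fermat_pow_cyc2.
by do 3?apply: finitely_generatedD; apply: finitely_generatedM;
  first [exact: finitely_generated1 | exact: finitely_generated_pow2].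
Qed.

End Reduction.

(** * Minimality for n = 3 *)

Section MinimalReduction3.
Variables x y z : R.
Hypothesis co : coordinates x y z.
Let co' := coordinates_cyc co.
Let co'' := coordinates_cyc co'.
Local Notation f := (fermat y z).
Local Notation g := (fermat z x).
Local Notation h := (fermat x y).
Local Notation q := (third_gen x y z).
Local Notation A := (fermat_pow x y z n n).
Local Notation J := (ideal_gen [:: f ^+ (n - 2) * g * h; f * g ^+ (n - 2) * h; q]).

(** J A^t lies in A^(t+1) = L A^t, so the determinant trick on A^t makes f g h and q integral over
    L; being a regular pair, they then lie in L. *)
Lemma reduction3_minimal L : n = 3%N -> is_reduction L A -> sub_ideal L J -> sub_ideal J L.
Proof.
move=> n3 [idL _ LA [t redL]] LJ.
have JE r : J r <-> pow2 (f * g * h) q 1 r.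
  have e1 : f ^+ (n - 2) * g * h = f * g * h by rewrite n3 expr1.
  have e2 : f * g ^+ (n - 2) * h = f * g * h by rewrite n3 expr1.
  rewrite e1 e2; split=> [/ideal_gen3 [u [v [w ->]]]|[u [v [_ ->]]]].
    by exists (u + v), w; split=> //; rewrite expr1; ring.
  by apply/ideal_gen3; exists u, 0, v; rewrite expr1; ring.
have fgh_neq0 : f * g * h != 0.
  by rewrite !mulf_neq0 // ?(fermat_neq0 co) ?(fermat_neq0 co') ?(fermat_neq0 co'').
have fgh_q : prime_to (f * g * h) q.
  move=> r qr; apply: (divides_fgh co).
  - by apply: (prime_to_third_gen co); apply: divides_trans qr; exists (g * h); ring.
  - move: qr; rewrite -third_gen_cyc => qr; apply: (prime_to_third_gen co').
    by apply: divides_trans qr; exists (f * h); ring.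
  - move: qr; rewrite -2!third_gen_cyc => qr; apply: (prime_to_third_gen co'').
    by apply: divides_trans qr; exists (f * g); ring.
have integral a : J a -> exists k, ideal_mul L (pow2 (f * g * h) q k) (a ^+ k.+1).
  move=> Ja; have idJ : is_ideal J by exact: ideal_gen_ideal.
  have [||b Ib|k aL] := @determinant_trick _ (ideal_exp A t) L J a _ _ idL LJ idJ Ja.
  - exact: finitely_generated_exp (finitely_generated_fermat_pow co).
  - exists ((f ^+ (n - 2) * g * h) ^+ t); last by rewrite n3 expf_neq0.
    by apply: ideal_expX; exact: fermat_pow_j1.
  - by apply/redL; apply: ideal_mul_mem => //; exact: reduction_sub.
  exists k; move: aL; apply: ideal_mulS => //; apply: ideal_exp_pow2 => r.
  by move/JE.
have [|i aL] := integral (f * g * h).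
  by apply/JE; exact: pow2_gen1.
have [|j bL] := integral q; first by apply/JE; exact: pow2_gen2.
have [|La Lb] := regular_pair_basic fgh_neq0 fgh_q idL _ aL bL.
  by move=> r /LJ/JE.
move=> _ /JE [u [v [_ ->]]]; have [_ LD LM] := idL.
by apply: LD; rewrite mulrC; [| rewrite expr1]; exact: LM.
Qed.

End MinimalReduction3.

End Coordinates.

(** Homogenization of X^n - 1: evaluate its factorization at y / z in the fraction field and
    multiply by z^n, with z = 0 apart. *)
Lemma prod_sub_roots (K : fieldType) (R : idomainType) (iota : {rmorphism K -> R})
    (n : nat) (W : seq K) : (0 < n)%N -> uniq W -> size W = n ->
  (forall w, w \in W -> w ^+ n = 1) ->
  forall y z : R, y ^+ n - z ^+ n = \prod_(w <- W) (y - iota w * z).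
Proof.
move=> n_gt0 uniqW sizeW W1 y z.
have [->|z0] := eqVneq z 0.
  rewrite expr0n gtn_eqF // subr0 -sizeW; elim: (W) => [|w s IHs]; first by rewrite big_nil.
  by rewrite big_cons exprS IHs mulr0 subr0.
have factorX : 'X^n - 1 = \prod_(w <- W) ('X - w%:P) :> {poly K}.
  rewrite (@all_roots_prod_XsubC _ ('X^n - 1) W).
  - by rewrite lead_coefXnsubC // scale1r.
  - by rewrite size_XnsubC // sizeW.
  - by apply/allP => w wW; rewrite rootE !hornerE W1 // subrr.
  - by rewrite uniq_rootsE.
pose F := {fraction R}; pose tof : {rmorphism R -> F} := @FracField.tofrac R.
pose phi : {rmorphism K -> F} := tof \o iota.
have zF0 : tof z != 0 by rewrite tofrac_eq0.
have homogE s : tof (\prod_(w <- s) (y - iota w * z))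
    = tof z ^+ size s * \prod_(w <- s) (tof y / tof z - phi w).
  elim: s => [|w s IHs]; first by rewrite !big_nil mulr1 rmorph1.
  rewrite !big_cons rmorphM IHs rmorphB rmorphM exprS /=.
  by rewrite -{1}(divfK zF0 (tof y)) -mulrBl (mulrC _ (tof z)) mulrACA.
apply/eqP; rewrite -tofrac_eq; apply/eqP; rewrite [RHS]homogE sizeW.
have := congr1 (fun p : {poly K} => (map_poly phi p).[tof y / tof z]) factorX.
rewrite rmorphB rmorphXn /= map_polyX rmorph1 rmorph_prod horner_prod hornerD hornerN.
rewrite hornerXn hornerC (eq_bigr (fun w => tof y / tof z - phi w)) => [<-|w _]; last first.
  by rewrite rmorphB /= map_polyX map_polyC hornerXsubC.
by rewrite expr_div_n mulrBr mulr1 mulrC divfK ?expf_neq0 // rmorphB !rmorphXn.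
Qed.

(** * Homogeneous components and orders of polynomials *)

Section Grading.
Variable K : fieldType.
Local Notation R := {mpoly K[3]}.
Implicit Types (p q r : R) (d e m k : nat).
Local Notation iota := (@mpolyC 3 K).

(** The r satisfying the last clause form a subring, so constants and variables suffice. *)
Lemma mpoly_coordinates : coordinates iota (var_x K) (var_y K) (var_z K).
Proof.
move=> a b c; have [rho [rx ry rz ri]] : exists rho : {rmorphism R -> R},
    [/\ rho (var_x K) = a, rho (var_y K) = b, rho (var_z K) = c
      & forall k : K, rho k%:MP = k%:MP].
  exists (comp_mpoly [tuple a; b; c]).
  by split; [exact: comp_mpolyXU | exact: comp_mpolyXU | exact: comp_mpolyXU |
    move=> k; exact: comp_mpolyC].
exists rho; split; [exact: rx | exact: ry | exact: rz | exact: ri |].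
pose P r := exists u v w, r - rho r = u * (var_x K - a) + v * (var_y K - b) + w * (var_z K - c).
have PD r s : P r -> P s -> P (r + s).
  move=> [u [v [w e]]] [u' [v' [w' e']]]; exists (u + u'), (v + v'), (w + w').
  by rewrite rmorphD opprD addrACA e e'; ring.
have PM r s : P r -> P s -> P (r * s).
  move=> [u [v [w e]]] [u' [v' [w' e']]].
  exists (u * s + rho r * u'), (v * s + rho r * v'), (w * s + rho r * w').
  rewrite rmorphM (_ : _ - _ = (r - rho r) * s + rho r * (s - rho s)); last by ring.
  by rewrite e e'; ring.
have PC (k : K) : P k%:MP by exists 0, 0, 0; rewrite ri; ring.
have PX i : P 'X_i.
  case: i => -[|[|[|//]]] i3.
  - rewrite (_ : Ordinal i3 = Ordinal (isT : 0 < 3)%N); last exact: val_inj.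
    by exists 1, 0, 0; rewrite -/(var_x K) rx; ring.
  - rewrite (_ : Ordinal i3 = Ordinal (isT : 1 < 3)%N); last exact: val_inj.
    by exists 0, 1, 0; rewrite -/(var_y K) ry; ring.
  - rewrite (_ : Ordinal i3 = Ordinal (isT : 2 < 3)%N); last exact: val_inj.
    by exists 0, 0, 1; rewrite -/(var_z K) rz; ring.
move=> r; rewrite -/(P r) [r]mpolyE; apply: (big_ind P) => //.
  by rewrite -mpolyC0.
move=> m _; rewrite -mul_mpolyC; apply: (PM) => //; rewrite mpolyXE_id.
apply: (big_ind P); [by rewrite -mpolyC1 | exact: PM | move=> i _].
by elim: (m i) => [|k IHk]; [rewrite expr0 -mpolyC1 | rewrite exprS; exact: PM].
Qed.

(* The substitution X_i -> X_i T: the coefficients in T of the image are the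
   homogeneous components. *)
Definition grade : {rmorphism R -> {poly R}} :=
  mmap (polyC \o iota) (fun i => ('X_i)%:P * 'X).

Lemma grade_coef p d : (grade p)`_d = pihomog mdeg d p.
Proof.
rewrite {1}[p]mpolyE rmorph_sum coef_sum pihomogE [RHS]big_mkcond /=.
apply: eq_bigr => m _; rewrite mmapZ mmapX /mmap1 /=.
rewrite (_ : \prod_(i < 3) _ = 'X_[m]%:P * 'X^(mdeg m)).
  rewrite mulrA -polyCM coefCM coefXn eq_sym -mul_mpolyC.
  by case: eqP => _; rewrite ?mulr1 ?mulr0.
rewrite (eq_bigr (fun i => ('X_i ^+ m i)%:P * 'X^(m i))) => [|i _]; last first.
  by rewrite exprMn rmorphXn.
by rewrite big_split /= -rmorph_prod -mpolyXE_id mdegE prodrXr.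
Qed.

(** Order at least m at the origin. As divisibility by T^m it is visibly additive on products. *)
Definition low m p := exists P, grade p = P * 'X^m.

Definition is_form d p := grade p = p%:P * 'X^d.

Lemma low0 m : low m 0.
Proof. by exists 0; rewrite rmorph0 mul0r. Qed.

Lemma lowD m p q : low m p -> low m q -> low m (p + q).
Proof. by move=> [P eP] [Q eQ]; exists (P + Q); rewrite rmorphD eP eQ mulrDl. Qed.

Lemma lowM m k p q : low m p -> low k q -> low (m + k) (p * q).
Proof.
by move=> [P eP] [Q eQ]; exists (P * Q); rewrite rmorphM eP eQ exprD mulrACA.
Qed.

Lemma low_any p : low 0 p.
Proof. by exists (grade p); rewrite mulr1. Qed.

Lemma low_mull m p q : low m q -> low m (p * q).
Proof. by move/(lowM (low_any p)). Qed.

Lemma low_mulr m p q : low m p -> low m (p * q).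
Proof. by rewrite mulrC; exact: low_mull. Qed.

Lemma low_ideal m : is_ideal (low m).
Proof. split; [exact: low0 | exact: lowD | move=> c a; exact: low_mull]. Qed.

Lemma is_form_low d p : is_form d p -> low d p.
Proof. by exists p%:P. Qed.

Lemma low_pow2 m p q k r : low m p -> low m q -> pow2 p q k r -> low (m * k) r.
Proof.
move=> mp mq; apply: (@pow2_min _ _ _ (fun k => low (m * k))).
- by move=> j; exact: low_ideal.
- by rewrite muln0; exact: low_any.
- by move=> j c cj; rewrite mulnS; split; exact: lowM.
Qed.

Lemma pihomog_low m d p : low m p -> (d < m)%N -> pihomog mdeg d p = 0.
Proof. by move=> [P eP] dm; rewrite -grade_coef eP coefMXn dm. Qed.

Lemma pihomogM_low m k p q : low m p -> low k q ->
  pihomog mdeg (m + k) (p * q) = pihomog mdeg m p * pihomog mdeg k q.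
Proof.
move=> [P eP] [Q eQ]; rewrite -!grade_coef rmorphM eP eQ mulrACA -exprD.
by rewrite !coefMXn !ltnn !subnn coef0M.
Qed.

Lemma pihomog_form d p : is_form d p -> pihomog mdeg d p = p.
Proof. by move=> hp; rewrite -grade_coef hp coefCM coefXn eqxx mulr1. Qed.

Lemma is_form_pihomog d p : is_form d (pihomog mdeg d p).
Proof.
apply/polyP => e; rewrite grade_coef coefCM coefXn.
case: eqP => [->|/eqP ne]; first by rewrite pihomog_id mulr1.
by rewrite mulr0 (pihomog_ne0 _ (pihomogP _ _ _)) // eq_sym.
Qed.

Lemma form_low_eq0 d m p : is_form d p -> low m p -> (d < m)%N -> p = 0.
Proof. by move=> hp /pihomog_low lp /lp; rewrite pihomog_form. Qed.

Lemma is_formB d p q : is_form d p -> is_form d q -> is_form d (p - q).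
Proof. by rewrite /is_form rmorphB => -> ->; rewrite polyCB mulrBl. Qed.

Lemma is_formD d p q : is_form d p -> is_form d q -> is_form d (p + q).
Proof. by rewrite /is_form rmorphD => -> ->; rewrite polyCD mulrDl. Qed.

Lemma is_formM d e p q : is_form d p -> is_form e q -> is_form (d + e) (p * q).
Proof. by rewrite /is_form rmorphM => -> ->; rewrite polyCM exprD mulrACA. Qed.

Lemma is_formX d k p : is_form d p -> is_form (d * k) (p ^+ k).
Proof. by rewrite /is_form rmorphXn => ->; rewrite rmorphXn exprMn exprM. Qed.

Lemma is_form_var i : is_form 1 'X_i.
Proof.
by rewrite /is_form /= mmapX mmap1U expr1.
Qed.

Lemma divides_pihomog d e p r : is_form e p -> divides p r -> divides p (pihomog mdeg d r).
Proof.
(* The witness is the component of c of degree d - e, and 0 when d < e. *)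
move=> hp [c ->]; exists ('X^e * grade c)`_d.
by rewrite -grade_coef rmorphM hp -mulrA coefCM.
Qed.

Lemma pihomog0C p : pihomog mdeg 0 p = (p@_0%MM)%:MP.
Proof.
rewrite pihomogE (eq_bigl (fun u => u == 0%MM)) => [|u]; last by rewrite mdeg_eq0.
have [p0|p0] := boolP (0%MM \in msupp p).
  rewrite big_mkcond (bigD1_seq 0%MM) ?msupp_uniq //= eqxx big1 ?addr0.
    by rewrite mpolyX0 alg_mpolyC.
  by move=> u /negPf ->.
rewrite (memN_msupp_eq0 p0) mpolyC0 big_seq_cond big1 // => u /andP[up /eqP u0].
by rewrite -u0 up in p0.
Qed.

Lemma ideal_pihomog d e p r : is_form e p -> exists c, pihomog mdeg d (r * p) = c * p.
Proof.
move=> hp; have pr : divides p (r * p) by exists r; rewrite mulrC.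
by have [c ->] := divides_pihomog d hp pr; exists c; rewrite mulrC.
Qed.

End Grading.

Lemma prime_toXl (R : idomainType) (a b : R) k :
  a != 0 -> b != 0 -> prime_to a b -> prime_to (a ^+ k) b.
Proof.
move=> a0 b0 ab; apply: prime_to_sym b0 _.
exact/prime_toX/prime_to_sym.
Qed.

Lemma eliminate (R : comNzRingType) (s s' u a b c d : R) :
  s' * s = 1 -> s * a + u * b = 0 -> c * a + d * b = (d - c * s' * u) * b.
Proof.
move=> ss e; rewrite -[c in LHS]mulr1 -ss.
by rewrite -[RHS]addr0 -(mulr0 (c * s')) -e; ring.
Qed.

Lemma cramer1 (R : comNzRingType) (s u s' u' a b : R) :
  (s * u' - s' * u) * a = u' * (s * a + u * b) - u * (s' * a + u' * b).
Proof. by ring. Qed.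

Lemma cramer2 (R : comNzRingType) (s u s' u' a b : R) :
  (s * u' - s' * u) * b = s * (s' * a + u' * b) - s' * (s * a + u * b).
Proof. by ring. Qed.

Lemma split_product (R : comNzRingType) (a b c q w s : R) :
  (a + c + w * q) * b - q * (w * s) = (a + c) * b + w * q * (b - s).
Proof. by ring. Qed.

(** * Degree arguments for n >= 4 *)

Section FermatReduction.
Variables (K : fieldType) (n : nat) (W : seq K).
Hypothesis n_ge3 : (3 <= n)%N.
Hypothesis uniqW : uniq W.
Hypothesis sizeW : size W = n.
Hypothesis W1 : forall w, w \in W -> w ^+ n = 1.
Local Notation R := {mpoly K[3]}.
Local Notation x := (var_x K).
Local Notation y := (var_y K).
Local Notation z := (var_z K).
Local Notation f := (fermat n y z).
Local Notation g := (fermat n z x).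
Local Notation h := (fermat n x y).
Local Notation q := (third_gen n x y z).
Local Notation A := (fermat_pow n x y z n n).
Local Notation j1 := (f ^+ (n - 2) * g * h).
Local Notation j2 := (f * g ^+ (n - 2) * h).
Local Notation J := (ideal_gen [:: j1; j2; q]).
Local Notation comp := (pihomog mdeg).
Let n_gt0 : (0 < n)%N. Proof. exact: leq_trans n_ge3. Qed.
Let co := @mpoly_coordinates K.
Let factor := @prod_sub_roots _ _ (@mpolyC 3 K) _ _ n_gt0 uniqW sizeW W1.

Lemma is_form_fermat (u v : R) : is_form 1 u -> is_form 1 v -> is_form n (fermat n u v).
Proof.
by move=> hu hv; rewrite -[n in is_form n](mul1n n); apply: is_formB; exact: is_formX.
Qed.

Let hx : is_form 1 x. Proof. exact: is_form_var. Qed.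
Let hy : is_form 1 y. Proof. exact: is_form_var. Qed.
Let hz : is_form 1 z. Proof. exact: is_form_var. Qed.
Let hf : is_form n f. Proof. exact: is_form_fermat. Qed.
Let hg : is_form n g. Proof. exact: is_form_fermat. Qed.
Let hh : is_form n h. Proof. exact: is_form_fermat. Qed.

Lemma is_form_j1 : is_form (n * n) j1.
Proof.
rewrite -[(n * n)%N](_ : n * (n - 2) + n + n = n * n)%N; last by move: n_ge3; clear; nia.
by do 2?apply: is_formM => //; exact: is_formX.
Qed.

Lemma is_form_j2 : is_form (n * n) j2.
Proof.
rewrite -[(n * n)%N](_ : n + n * (n - 2) + n = n * n)%N; last by move: n_ge3; clear; nia.
by do 2?apply: is_formM => //; exact: is_formX.
Qed.

Lemma is_form_third_gen : is_form (n * n + n) q.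
Proof.
have H (a b c : R) : is_form n a -> is_form n b -> is_form 1 c -> is_form (n * n + n) (a ^+ (n - 2) * b ^+ 2 * c ^+ n).
  move=> ha hb hc.
  rewrite -[(n * n + n)%N](_ : n * (n - 2) + n * 2 + 1 * n = n * n + n)%N; last by move: n_ge3; clear; nia.
  by do 2?apply: is_formM => //; exact: is_formX.
by do 2?apply: is_formD; exact: H.
Qed.

Lemma fermat_pow_low r : A r -> low (n * n) r.
Proof. by case=> rD _ _ _; apply: low_pow2 rD; exact: is_form_low. Qed.

Lemma fermat_exp_low m r : ideal_exp A m r -> low (n * n * m) r.
Proof.
elim: m r => [|m IHm] r; first by rewrite muln0 => _; exact: low_any.
move: r; apply: ideal_mul_min => [|a b aA /IHm bA]; first exact: low_ideal.
by rewrite mulnS; apply: lowM => //; exact: fermat_pow_low.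
Qed.

Lemma fermat_pow_mod r : A r -> exists s, low (n * n + n) s /\ divides f (r - s).
Proof.
case=> rD ry _ _; have [c [cy dv]] := fermat_mod n_ge3 co rD ry.
exists (g ^+ n * c); split=> //; apply: lowM; first exact/is_form_low/is_formX.
by rewrite -[n in low n](mul1n n); apply: low_pow2 cy; exact: is_form_low.
Qed.

Lemma fermat_exp_mod m r : ideal_exp A m r ->
  exists s, low ((n * n + n) * m) s /\ divides f (r - s).
Proof.
elim: m r => [|m IHm] r.
  by rewrite muln0 => _; exists r; rewrite subrr; split; [exact: low_any | exact: divides0].
move: r; apply: ideal_mul_min => [|a b aA /IHm [t [lt [v ev]]]].
  split; first by exists 0; rewrite subrr; split; [exact: low0 | exact: divides0].
    move=> a b [s [ls fs]] [t [lt ft]]; exists (s + t); split; first exact: lowD.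
    by rewrite opprD addrACA; exact: dividesD.
  move=> c a [s [ls fs]]; exists (c * s); split; first exact: low_mull.
  by rewrite -mulrBr; exact: divides_mull.
have [s [ls [u eu]]] := fermat_pow_mod aA; exists (s * t).
split; first by rewrite mulnS; exact: lowM.
have -> : a * b - s * t = (a - s) * b + s * (b - t) by ring.
by rewrite eu ev; apply: dividesD; [exists (u * b) | exists (s * v)]; ring.
Qed.

Lemma fermat_pow_comp r : A r -> divides f (comp (n * n) r).
Proof.
move/fermat_pow_mod=> [s [ls fs]]; rewrite -[r](subrK s) pihomogD.
rewrite (pihomog_low ls) ?addr0; last by move: n_ge3; clear; nia.
exact: divides_pihomog hf fs.
Qed.

(* If the initial forms of L were all multiples of l, then l^k would divide
   both j1^(t+k) and j2^(t+k), hence (f g h)^(t+k), against degrees for k large. *)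
Lemma initial_forms L t (l : R) : (4 <= n)%N -> is_ideal L -> sub_ideal L A ->
  sub_ideal (ideal_exp A t.+1) (ideal_mul L (ideal_exp A t)) -> low (n * n) l ->
  (forall r, L r -> exists c : K, comp (n * n) r = c%:MP * l) -> False.
Proof.
move=> n_ge4 idL LA red ll Ll.
have step k r : ideal_exp A (k + t) r ->
    low (n * n * (k + t)) r /\ divides (l ^+ k) (comp (n * n * (k + t)) r).
  elim: k r => [|k IHk] r.
    move=> rA; split; first exact: fermat_exp_low.
    by exists (comp (n * n * (0 + t)) r); rewrite mul1r.
  rewrite addSn => /(reduction_in_exp red).
  move: r; apply: ideal_mul_min => [|a b aL bA].
    split.
    - by rewrite pihomog0; split; [exact: low0 | exact: divides0].
    - by move=> a b [la da] [lb db]; rewrite pihomogD; split; [exact: lowD | exact: dividesD].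
    - move=> c a [la da]; split; first exact: low_mull.
      by rewrite -[(_ * _.+1)%N]add0n pihomogM_low; [exact: divides_mull | exact: low_any | ].
  have [lb [u eu]] := IHk _ bA; have la := fermat_pow_low (LA _ aL).
  rewrite mulnS pihomogM_low //; split; first exact: lowM.
  have [c ->] := Ll _ aL; exists (c%:MP * u); rewrite eu exprS.
  by rewrite [RHS]mulrACA (mulrC l).
(* The degree 3n(k + t) of (f g h)^N must be less than the order n^2 k of l^k, that is (n - 3) k >
   3t; for n >= 4 it is enough that k > 3t. *)
pose k := (3 * t).+1; pose N := (k + t)%N.
have f0 : f != 0 := fermat_neq0 n_ge3 co.
have g0 : g != 0 := fermat_neq0 n_ge3 (coordinates_cyc co).
have h0 : h != 0 := fermat_neq0 n_ge3 (coordinates_cyc (coordinates_cyc co)).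
have dvN (j : R) : A j -> is_form (n * n) j -> divides (l ^+ k) (j ^+ N).
  move=> jA hj; have [_] := step k _ (ideal_expX N jA).
  by rewrite pihomog_form //; exact: is_formX.
have [a1 e1] := dvN _ (fermat_pow_j1 n_ge3 x y z) is_form_j1.
have [a2 e2] := dvN _ (fermat_pow_j2 n_ge3 x y z) is_form_j2.
have l0 : l != 0.
  apply/eqP => l0; have /eqP := e1; rewrite l0 expr0n mul0r expf_eq0.
  by rewrite !mulf_eq0 expf_eq0 (negPf f0) (negPf g0) (negPf h0) !andbF.
(* [j1] and [j2] are f g h times f^(n-3) and g^(n-3). Since F and G are relatively prime, a common
   divisor l^k of (f g h)^N F and (f g h)^N G divides (f g h)^N. *)
pose F := f ^+ ((n - 3) * N); pose G := g ^+ ((n - 3) * N).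
have eF : l ^+ k * a1 = (f * g * h) ^+ N * F.
  rewrite -e1 /F exprM -exprMn; congr (_ ^+ _).
  by rewrite -(subnSK n_ge3) exprS; move: (f ^+ _) => u; ring.
have eG : l ^+ k * a2 = (f * g * h) ^+ N * G.
  rewrite -e2 /G exprM -exprMn; congr (_ ^+ _).
  by rewrite -(subnSK n_ge3) exprS; move: (g ^+ _) => u; ring.
have FG : prime_to F G.
  have fg : prime_to f g by move=> r; exact: (prime_to_fermat n_ge3 factor co).
  exact: prime_toX (prime_toXl f0 g0 fg).
have [|c ec] := FG a1.
  exists a2; apply: (mulfI (expf_neq0 k l0)).
  by rewrite mulrCA eF [RHS]mulrCA eG; ring.
have F0 : F != 0 by rewrite expf_neq0.
have /eqP : (f * g * h) ^+ N = l ^+ k * c.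
  by apply: (mulIf F0); rewrite -eF ec; ring.
rewrite -[_ ^+ N]/((f * g * h) ^+ N) => /eqP e.
have : (f * g * h) ^+ N = 0.
  apply: (@form_low_eq0 _ ((n + n + n) * N) (n * n * k)).
  - by apply: is_formX; do 2?apply: is_formM.
  - by rewrite e; apply: low_mulr; apply: (@low_pow2 _ _ l l); [| | apply: pow2X1; exact: pow2_gen1].
  - by rewrite /N /k; move: n_ge4; clear; nia.
by move/eqP; rewrite expf_eq0 !mulf_eq0 (negPf f0) (negPf g0) (negPf h0) andbF.
Qed.

Lemma low_mpolyC (a : R) : a@_0%MM = 0 -> low 1 a.
Proof.
move=> a0; exists (\poly_(i < size (grade K a)) (grade K a)`_i.+1).
apply/polyP => -[|i]; first by rewrite grade_coef pihomog0C a0 coefMX mpolyC0.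
rewrite coefMX /= coef_poly; case: ltnP => // szi.
by rewrite nth_default // ltnW.
Qed.

Lemma comp_low d (c a : R) : low d a -> comp d (c * a) = (c@_0%MM)%:MP * comp d a.
Proof. by move=> la; rewrite -[d]add0n pihomogM_low ?pihomog0C //; exact: low_any. Qed.

(** The components [a0], [b0] of degree n^2 are independent over K, by [initial_forms], and lie in L
    by homogeneity. The matrix expressing them by a and b is then the identity at the origin, and
    its determinant D has constant term 1. Cramer's rule puts D L in (a0, b0), hence in (f); applied
    to q^(t+1) this makes f divide D, which is absurd. *)
Lemma no_two_generators : (4 <= n)%N ->
  ~ exists a b, is_homogeneous_reduction (ideal_gen [:: a; b]) A.
Proof.
move=> n_ge4 [a [b [[idL _ LA [t redL]] homL]]].
set L := ideal_gen _ in idL LA redL homL.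
have [_ LD LM] := idL.
have La : L a by apply: ideal_gen_mem; rewrite mem_head.
have Lb : L b by apply: ideal_gen_mem; rewrite inE mem_head orbT.
pose a0 := comp (n * n) a; pose b0 := comp (n * n) b.
have la := fermat_pow_low (LA _ La); have lb := fermat_pow_low (LA _ Lb).
have compL c d : comp (n * n) (c * a + d * b) = (c@_0%MM)%:MP * a0 + (d@_0%MM)%:MP * b0.
  by rewrite pihomogD !comp_low.
have single l : low (n * n) l ->
    (forall s u : K, exists v : K, s%:MP * a0 + u%:MP * b0 = v%:MP * l) -> False.
  move=> ll Hl; apply: (initial_forms n_ge4 idL LA _ ll).
    by move=> r /(redL r).1; exact.
  by move=> r /ideal_gen2 [c [d ->]]; rewrite compL.
have form_low (r : R) : low (n * n) (comp (n * n) r) by exact/is_form_low/is_form_pihomog.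
have free (s u : K) : s%:MP * a0 + u%:MP * b0 = 0 -> s = 0 /\ u = 0.
  have unitC (v : K) : v != 0 -> (v^-1)%:MP * v%:MP = 1 :> R.
    by move=> v0; rewrite -mpolyCM mulVf // mpolyC1.
  move=> e; split; apply: NNPP => /eqP nz.
    apply: (single b0 (form_low b)) => s' u'; exists (u' - s' * s^-1 * u).
    by rewrite (eliminate _ _ (unitC _ nz) e) mpolyCB !mpolyCM.
  rewrite addrC in e.
  apply: (single a0 (form_low a)) => s' u'; exists (s' - u' * u^-1 * s).
  by rewrite addrC (eliminate _ _ (unitC _ nz) e) mpolyCB !mpolyCM.
have /ideal_gen2 [c1 [d1 e1]] : L a0 by apply: homL.
have /ideal_gen2 [c2 [d2 e2]] : L b0 by apply: homL.
have E1 := compL c1 d1; have E2 := compL c2 d2.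
rewrite -e1 pihomog_id in E1; rewrite -e2 pihomog_id in E2.
have [s1 u1] : c1@_0%MM - 1 = 0 /\ d1@_0%MM = 0.
  by apply: free; rewrite mpolyCB mpolyC1 mulrBl mul1r addrAC -E1 subrr.
have [s2 u2] : c2@_0%MM = 0 /\ d2@_0%MM - 1 = 0.
  by apply: free; rewrite mpolyCB mpolyC1 mulrBl mul1r addrA -E2 subrr.
pose D := c1 * d2 - d1 * c2.
have D0 : D@_0%MM = 1.
  rewrite mcoeffB !rmorphM /= u1 mul0r subr0.
  by rewrite -[c1@__](subrK 1) -[d2@__](subrK 1) s1 u2 !add0r mulr1.
have fa : divides f a0 := fermat_pow_comp (LA _ La).
have fb : divides f b0 := fermat_pow_comp (LA _ Lb).
have fD r : L r -> divides f (D * r).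
  case/ideal_gen2 => c [d ->].
  have -> : D * (c * a + d * b) = (c * d2 - d * c2) * a0 + (d * c1 - c * d1) * b0.
    by rewrite e1 e2 /D; ring.
  by apply: dividesD; exact: divides_mull.
have : divides f (D * q ^+ t.+1).
  apply: fD; apply: (@ideal_mul_subl _ L (ideal_exp A t) idL); apply/redL.
  by apply: ideal_expX; exact: third_gen_pow.
have fq : prime_to f q by move=> r; exact: (prime_to_third_gen n_ge3 factor co).
rewrite mulrC => /(prime_toX fq) [c eD].
have : comp 0 D = 0.
  by apply: (@pihomog_low _ n) => //; rewrite eD; apply: low_mulr; exact: is_form_low.
by rewrite pihomog0C D0 mpolyC1 => /eqP; rewrite oner_eq0.
Qed.

Lemma reduction_homogeneous : is_homogeneous J.
Proof.
move=> r d /ideal_gen3 [u [v [w ->]]]; rewrite !pihomogD.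
have [u' ->] := ideal_pihomog d u is_form_j1.
have [v' ->] := ideal_pihomog d v is_form_j2.
have [w' ->] := ideal_pihomog d w is_form_third_gen.
by apply/ideal_gen3; exists u', v', w'.
Qed.

(* By [initial_forms] a smaller homogeneous reduction contains j1 and j2; if it
   missed q as well, it would lie in (j1, j2) + m q, and q^(t+1) would be too
   deep modulo f. *)
Lemma homogeneous_minimal L : (4 <= n)%N ->
  is_homogeneous_reduction L A -> sub_ideal L J -> sub_ideal J L.
Proof.
move=> n_ge4 [[idL _ LA [t redL]] homL] LJ; have [L0 LD LM] := idL.
have sub_red : sub_ideal (ideal_exp A t.+1) (ideal_mul L (ideal_exp A t)).
  by move=> r /(redL r).1.
have low1 := is_form_low is_form_j1; have low2 := is_form_low is_form_j2.
have comp1 := pihomog_form is_form_j1; have comp2 := pihomog_form is_form_j2.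
have compL r : L r -> exists s u : K,
    comp (n * n) r = s%:MP * j1 + u%:MP * j2 /\ L (s%:MP * j1 + u%:MP * j2).
  move=> Lr; have /ideal_gen3 [c [d [w er]]] := LJ _ Lr.
  exists c@_0%MM, d@_0%MM.
  have e : comp (n * n) r = (c@_0%MM)%:MP * j1 + (d@_0%MM)%:MP * j2.
    have lw : low (n * n + n) (w * q) by apply: low_mull; exact/is_form_low/is_form_third_gen.
    rewrite er !pihomogD (comp_low c low1) (comp_low d low2) comp1 comp2 (pihomog_low lw) ?addr0 //.
    by move: n_ge3; clear; nia.
  by split=> //; rewrite -e; exact: homL.
have low12 (s u : K) : low (n * n) (s%:MP * j1 + u%:MP * j2).
  by apply: lowD; exact: low_mull.
have unitC (v : K) : v != 0 -> (v^-1)%:MP * v%:MP = 1 :> R.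
  by move=> v0; rewrite -mpolyCM mulVf // mpolyC1.
have scaleC (s u s' u' k : K) (a b : R) : s' = k * s -> u' = k * u ->
    s'%:MP * a + u'%:MP * b = k%:MP * (s%:MP * a + u%:MP * b).
  by move=> -> ->; rewrite !mpolyCM mulrDr !mulrA.
have [Lj1 Lj2] : L j1 /\ L j2.
  apply: NNPP => Nj.
  (* The combinations of [j1] and [j2] in L form a K-vector space. Unless it contains both, any two
     of them are proportional, so all initial forms of L are multiples of one form. *)
  have det0 (s u s' u' : K) : L (s%:MP * j1 + u%:MP * j2) ->
      L (s'%:MP * j1 + u'%:MP * j2) -> s * u' - s' * u = 0.
    move=> Lv Lv'; apply: NNPP => /eqP dt; apply: Nj.
    have divd (p : R) : L ((s * u' - s' * u)%:MP * p) -> L p.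
      by move/(LM ((s * u' - s' * u)^-1)%:MP _); rewrite mulrA unitC // mul1r.
    have [m1 m2 m3 m4] := And4 (LM u'%:MP _ Lv) (LM u%:MP _ Lv') (LM s'%:MP _ Lv) (LM s%:MP _ Lv').
    split; apply: divd.
      have -> : (s * u' - s' * u)%:MP * j1 =
          u'%:MP * (s%:MP * j1 + u%:MP * j2) - u%:MP * (s'%:MP * j1 + u'%:MP * j2).
        rewrite mpolyCB !mpolyCM; exact: cramer1.
      exact: idealB.
    have -> : (s * u' - s' * u)%:MP * j2 =
        s%:MP * (s'%:MP * j1 + u'%:MP * j2) - s'%:MP * (s%:MP * j1 + u%:MP * j2).
      rewrite mpolyCB !mpolyCM; exact: cramer2.
    exact: idealB.
  have [[s [u [Lv nz]]]|Nv] := classic (exists s u : K,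
      L (s%:MP * j1 + u%:MP * j2) /\ (s != 0) || (u != 0)).
    apply: (initial_forms n_ge4 idL LA sub_red (low12 s u)) => r /compL [s' [u' [-> Lv']]].
    have e := det0 _ _ _ _ Lv Lv'; case/orP: nz => nz.
      exists (s' / s); apply: scaleC; first by rewrite divfK.
      apply: (mulfI nz); rewrite mulrA (mulrC s (s' / s)) divfK //.
      by apply/eqP; rewrite -subr_eq0 e.
    exists (u' / u); apply: scaleC; last by rewrite divfK.
    apply: (mulfI nz); rewrite mulrA (mulrC u (u' / u)) divfK // mulrC (mulrC u').
    by apply/eqP; rewrite eq_sym -subr_eq0 e.
  apply: (initial_forms n_ge4 idL LA sub_red (low0 _ _)) => r /compL [s [u [-> Lv]]].
  exists 0; rewrite mulr0.
  have [s0|/eqP s0] := classic (s = 0); last by case: Nv; exists s, u; rewrite s0.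
  have [u0|/eqP u0] := classic (u = 0); last by case: Nv; exists s, u; rewrite u0 orbT.
  by rewrite s0 u0 mpolyC0 !mul0r addr0.
suff Lq : L q.
  apply: ideal_gen_min => // a; rewrite !inE.
  by case/or3P=> /eqP ->.
apply: NNPP => NLq.
(* By homogeneity a nonzero constant term of w would put a nonzero scalar multiple of q in L. *)
have NL w : L (w * q) -> low 1 w.
  move=> Lw; apply: low_mpolyC; apply: NNPP => /eqP w0; apply: NLq.
  have := homL _ (n * n + n)%N Lw.
  rewrite comp_low; last exact/is_form_low/is_form_third_gen.
  rewrite (pihomog_form is_form_third_gen) => /(LM ((w@_0%MM)^-1)%:MP _).
  by rewrite mulrA unitC // mul1r.
have fq : prime_to f q by move=> r; exact: (prime_to_third_gen n_ge3 factor co).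
(* Modulo f, elements of L are w q with w of order at least 1, and elements of A^t have order at
   least (n^2 + n) t. So q^(t+1) = q s with s of order larger than the degree of q^t; cancelling q
   then makes f divide q^t. *)
have [s [ls fs]] : exists s, low ((n * n + n) * t).+1 s /\ divides f (q ^+ t.+1 - q * s).
  have : ideal_mul L (ideal_exp A t) (q ^+ t.+1).
    by apply/redL; apply: ideal_expX; exact: third_gen_pow.
  move: (q ^+ t.+1); apply: ideal_mul_min => [|a b aL bA].
    split.
    - by exists 0; rewrite mulr0 subr0; split; [exact: low0 | exact: divides0].
    - move=> a b [s [ls fs]] [u [lu fu]]; exists (s + u); split; first exact: lowD.
      by rewrite mulrDr opprD addrACA; exact: dividesD.
    - move=> c a [s [ls fs]]; exists (c * s); split; first exact: low_mull.
      by rewrite mulrCA -mulrBr; exact: divides_mull.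
  have /ideal_gen3 [c [d [w ea]]] := LJ _ aL.
  have lw : low 1 w.
    apply: NL; have -> : w * q = a - c * j1 - d * j2 by rewrite ea -addrA -opprD addrC addKr.
    by apply: idealB => //; [apply: idealB => //|]; exact: LM.
  have [s [ls fs]] := fermat_exp_mod bA.
  exists (w * s); split; first by rewrite -add1n; exact: lowM.
  have fj : divides f (c * j1 + d * j2).
    apply: dividesD; apply: divides_mull; last first.
      by exists (g ^+ (n - 2) * h); rewrite mulrA.
    by exists (f ^+ (n - 3) * g * h); rewrite -(subnSK n_ge3) exprS !mulrA.
  have -> : a * b - q * (w * s) = (c * j1 + d * j2) * b + w * q * (b - s).
    by rewrite ea; exact: split_product.
  by apply: dividesD; [exact: divides_mulr | exact: divides_mull].
have [c ec] : divides f (q ^+ t - s).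
  by apply: fq; rewrite mulrBr -exprS.
have hqt : is_form ((n * n + n) * t) (q ^+ t) by apply: is_formX; exact: is_form_third_gen.
have fqt : divides f (q ^+ t).
  rewrite -(pihomog_form hqt) -[X in comp _ X](subrK s) pihomogD.
  rewrite (pihomog_low ls) // addr0; apply: divides_pihomog hf _.
  by exists c.
have [e f1] : divides f 1 by apply: (prime_toX fq (k := t)); rewrite mulr1.
have : low n (1 : R) by rewrite f1; apply: low_mulr; exact: is_form_low.
move/pihomog_low/(_ n_gt0); rewrite pihomog0C mcoeff1 eqxx mpolyC1.
by move/eqP; rewrite oner_eq0.
Qed.

End FermatReduction.

Theorem proposition5p1 (n : nat) (hn : (3 <= n)%N) (K : fieldType)
    (hK : exists s : seq K,
        [/\ uniq s, size s = n & forall w, w \in s -> w ^+ n = 1]) :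
  let x := var_x K in let y := var_y K in let z := var_z K in
  let f := fermat_f K n in let g := fermat_g K n in let h := fermat_h K n in
  let A := symbolic_power (fermat_ideal K n) n in
  let J := ideal_gen
    (if n == 3%N then
       [:: f * g * h;
           g * f ^+ 2 * x ^+ n + h * g ^+ 2 * y ^+ n + f * h ^+ 2 * z ^+ n]
     else
       [:: f ^+ (n - 2) * g * h;
           f * g ^+ (n - 2) * h;
           g ^+ (n - 2) * f ^+ 2 * x ^+ n + h ^+ (n - 2) * g ^+ 2 * y ^+ n
             + f ^+ (n - 2) * h ^+ 2 * z ^+ n]) in
  ((4 <= n)%N ->
     ~ exists a b, is_homogeneous_reduction (ideal_gen [:: a; b]) A)
  /\ (is_homogeneous_minimal_reduction J A
      /\ (n = 3%N -> is_minimal_reduction J A)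
      /\ is_reduction_number J A 1).
Proof.
case: hK => W [uniqW sizeW W1] x y z f g h A J.
have co := @mpoly_coordinates K.
have factor := prod_sub_roots (@mpolyC 3 K) (leq_trans (isT : 0 < 3)%N hn) uniqW sizeW W1.
have -> : A = fermat_pow n x y z n n.
  apply: ideal_ext => r.
  exact: (fermat_symbolic_power hn factor uniqW co).
pose j1 := fermat n y z ^+ (n - 2) * fermat n z x * fermat n x y.
pose j2 := fermat n y z * fermat n z x ^+ (n - 2) * fermat n x y.
(* For n = 3 both [j1] and [j2] equal f g h, so the list with three generators describes J in either
   case. *)
have -> : J = ideal_gen [:: j1; j2; third_gen n x y z].
  rewrite /J /third_gen /j1 /j2 /f /g /h /fermat_f /fermat_g /fermat_h -!/(fermat n _ _) -/x -/y -/z.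
  case: eqP => [n3|//]; apply: ideal_ext => r.
  have -> : (n - 2 = 1)%N by rewrite n3.
  rewrite !expr1; split.
    by case/ideal_gen2=> c [d ->]; apply/ideal_gen3; exists c, 0, d; rewrite mul0r addr0.
  case/ideal_gen3=> c [d [e ->]]; apply/ideal_gen2; exists (c + d), e.
  by rewrite [(c + d) * _]mulrDl.
have minimal L : is_homogeneous_reduction L (fermat_pow n x y z n n) ->
    sub_ideal L (ideal_gen [:: j1; j2; third_gen n x y z]) ->
    sub_ideal (ideal_gen [:: j1; j2; third_gen n x y z]) L.
  move=> redL LJ; have [n_ge4|n_lt4] := leqP 4 n.
    exact: (homogeneous_minimal hn uniqW sizeW W1 n_ge4 redL LJ).
  have n3 : n = 3%N by move: hn n_lt4; lia.
  by case: redL => redL _; exact: (reduction3_minimal hn factor co n3 redL LJ).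
have red := fermat_is_reduction hn sizeW factor co.
split; first exact: (no_two_generators hn uniqW sizeW W1).
split; [|split].
- split; first by split; [exact: red | exact: (reduction_homogeneous hn)].
  by case=> L [[LJ nJL] redL]; apply: nJL; exact: minimal.
- move=> n3; split; first exact: red.
  case=> L [[LJ nJL] redL]; apply: nJL.
  exact: (reduction3_minimal hn factor co n3 redL LJ).
- exact: (fermat_reduction_number hn sizeW factor co).
Qed.
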